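(* Let $n\ge 1$ and let $\psi$ be the map from $\{z\in\mathbb{S}^{2n+1}:z_{n+1}\ne0\}$ to $\mathbb{R}_{\ge 0}\times\mathbb{R}/2\pi\mathbb{Z}$ such that $$\psi\left(\frac{w_1e^{i\theta}}{\sqrt{1+\rho^2}},\dots,\frac{w_ne^{i\theta}}{\sqrt{1+\rho^2}},\frac{e^{i\theta}}{\sqrt{1+\rho^2}}\right)=(\rho,\theta),\qquad w\in\mathbb{C}^n,\ \rho=\Big(\sum_{j=1}^n|w_j|^2\Big)^{1/2},\ \theta\in\mathbb{R}/2\pi\mathbb{Z}.$$ Let $\mathcal{D}$ be the space of smooth functions $f:\mathbb{R}_{\ge0}\times\mathbb{R}/2\pi\mathbb{Z}\to\mathbb{R}$ such that $\frac{\partial f}{\partial\rho}=0$ when $\rho=0$, and let $$\tilde L=(1+\rho^2)^2\frac{\partial^2}{\partial\rho^2}+\left(\frac{(2n-1)(1+\rho^2)}{\rho}+(1+\rho^2)\rho\right)\frac{\partial}{\partial\rho}+\rho^2\frac{\partial^2}{\partial\theta^2}.$$ Then for every $f\in\mathcal{D}$, $$L(f\circ\psi)=(\tilde L f)\circ\psi,$$ where $L$ is the sub-Laplacian of $\mathbb{S}^{2n+1}$.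
   Context: $\mathbb{S}^{2n+1}=\{z\in\mathbb{C}^{n+1}:\|z\|=1\}$. The sub-Laplacian $L$ is the second order differential operator $$L=2\sum_{j=1}^{n+1}(T_j\overline{T_j}+\overline{T_j}T_j),\qquad T_j=\frac{\partial}{\partial z_j}-\overline{z_j}\,\mathcal{S},\qquad \mathcal{S}=\sum_{k=1}^{n+1}z_k\frac{\partial}{\partial z_k}$$ (the $T_j$ are tangent to the sphere). Equivalently $L=\Delta-T^2$, where $\Delta$ is the Laplace-Beltrami operator of the round metric on $\mathbb{S}^{2n+1}$ and $Tf(z)=\frac{d}{d\theta}f(e^{i\theta}z)|_{\theta=0}$. At $\rho=0$ the term $\frac1\rho\frac{\partial f}{\partial\rho}$ in $\tilde Lf$ is understood as its limit $\frac{\partial^2 f}{\partial\rho^2}(0,\theta)$. *)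

(* Defs.v *)
From HB Require Import structures.
From mathcomp Require Import all_boot all_order all_algebra.
From mathcomp Require Import complex.
From mathcomp Require Import all_classical all_reals all_analysis.

Set Implicit Arguments.
Unset Strict Implicit.
Unset Printing Implicit Defensive.
Import Order.TTheory GRing.Theory Num.Theory.
Import numFieldNormedType.Exports.
Local Open Scope classical_set_scope.
Local Open Scope ring_scope.
Local Open Scope complex_scope.

Section ComplexSpace.
Context {R : realType}.

Definition hnorm m (z : 'rV[R[i]]_m) : R :=
  Num.sqrt (\sum_(j < m) (complex.Re (z 0 j) ^+ 2 + complex.Im (z 0 j) ^+ 2)).

Definition expi (t : R) : R[i] := cos t +i* sin t.

(* R[i] has no topology over R in the library, so curves in R[i] are
   differentiated componentwise. *)
Definition cderivable (c : R -> R[i]) (t : R) : Prop :=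
  derivable (@complex.Re R \o c) t 1 /\ derivable (@complex.Im R \o c) t 1.

Definition cderive1 (c : R -> R[i]) (t : R) : R[i] :=
  derive1 (@complex.Re R \o c) t +i* derive1 (@complex.Im R \o c) t.

Section Wirtinger.
Context {m : nat}.
Implicit Types (G : 'rV[R[i]]_m -> R[i]) (z : 'rV[R[i]]_m) (j : 'I_m).

(* With z_j = x_j + i y_j, the curves along which d/dx_j and d/dy_j are taken *)
Definition xline j G z : R -> R[i] :=
  fun t => G (z + t%:C *: delta_mx 0 j).
Definition yline j G z : R -> R[i] :=
  fun t => G (z + ('i%C * t%:C) *: delta_mx 0 j).

Definition dx j G z : R[i] := cderive1 (xline j G z) 0.
Definition dy j G z : R[i] := cderive1 (yline j G z) 0.

Definition pderivable G z : Prop :=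
  forall j, cderivable (xline j G z) 0 /\ cderivable (yline j G z) 0.

Definition dz j G z : R[i] := (dx j G z - 'i%C * dy j G z) / 2%:R.
Definition dzbar j G z : R[i] := (dx j G z + 'i%C * dy j G z) / 2%:R.

Definition euler G z : R[i] := \sum_(k < m) z 0 k * dz k G z.
Definition eulerbar G z : R[i] := \sum_(k < m) (z 0 k)^*%C * dzbar k G z.

Definition Tfield j G z : R[i] := dz j G z - (z 0 j)^*%C * euler G z.
Definition Tbarfield j G z : R[i] := dzbar j G z - z 0 j * eulerbar G z.

(* Functions on (an open subset of) the unit sphere are extended to be constant
   on rays.  As the T_j are tangent to the sphere, the values on the sphere of
   L applied to an extension do not depend on the chosen C^2 extension. *)
Definition sphere_ext G : 'rV[R[i]]_m -> R[i] :=
  fun z => G ((hnorm z)^-1%:C *: z).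

Definition sub_laplacian G z : R[i] :=
  2%:R * \sum_(j < m) (Tfield j (Tbarfield j (sphere_ext G)) z
                       + Tbarfield j (Tfield j (sphere_ext G)) z).

(* Derivatives are total functions in the library; this says that all those
   occurring in sub_laplacian G exist on the cone A. *)
Definition sub_laplacian_defined (A : set 'rV[R[i]]_m) G : Prop :=
  forall z, A z ->
    [/\ pderivable (sphere_ext G) z,
        forall j, pderivable (Tfield j (sphere_ext G)) z
      & forall j, pderivable (Tbarfield j (sphere_ext G)) z].

End Wirtinger.

Definition zlast n (z : 'rV[R[i]]_(n + 1)) : R[i] := z 0 (rshift n ord0).

Definition chart_point n (w : 'rV[R[i]]_n) (t : R) : 'rV[R[i]]_(n + 1) :=
  (expi t / (Num.sqrt (1 + hnorm w ^+ 2))%:C) *: row_mx w (const_mx 1).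

(* Elements of R/2piZ are given by real representatives. *)
Definition is_psi n (psi : 'rV[R[i]]_(n + 1) -> R * R) : Prop :=
  forall (w : 'rV[R[i]]_n) (t : R),
    (psi (chart_point w t)).1 = hnorm w /\
    exists k : int, (psi (chart_point w t)).2 = t + k%:~R * (2 * pi).

End ComplexSpace.

(* A function on R_{>=0} x R/2piZ is represented by f : R -> R -> R, 2pi-periodic
   in its second argument; the definitions below only use the values f r t with
   0 <= r.  In particular the derivative in r is one-sided at r = 0. *)
Section HalfPlane.
Context {R : realType}.
Implicit Types f : R -> R -> R.

Definition drho_quot f (r t : R) : R -> R :=
  fun h => h^-1 * (f (r + h) t - f r t).

Definition rho_nbhs (r : R) : set_system R :=
  within [set h | 0 <= r + h] (0 : R)^'.

Definition drho f (r t : R) : R := lim (drho_quot f r t @ rho_nbhs r).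

Definition dtheta f (r t : R) : R := derive1 (f r) t.

(* C^k up to the boundary *)
Fixpoint Ck_half (k : nat) f : Prop :=
  {within [set p : R * R | 0 <= p.1], continuous (fun p => f p.1 p.2)} /\
  match k with
  | 0%N => True
  | k'.+1 =>
    [/\ forall r t, 0 <= r -> cvg (drho_quot f r t @ rho_nbhs r),
        forall r t, 0 <= r -> derivable (f r) t 1,
        Ck_half k' (drho f)
      & Ck_half k' (dtheta f)]
  end.

Definition in_D f : Prop :=
  [/\ forall r t, 0 <= r -> f r (t + 2 * pi) = f r t,
      forall k, Ck_half k f
    & forall t, drho f 0 t = 0].

(* (1 / r) * df/dr, understood as its limit at r = 0 *)
Definition drho_over_rho f (r t : R) : R :=
  if r == 0 then drho (drho f) 0 t else r^-1 * drho f r t.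

Definition Ltilde (n : nat) f (r t : R) : R :=
  (1 + r ^+ 2) ^+ 2 * drho (drho f) r t
  + ((2 * n%:R - 1) * (1 + r ^+ 2) * drho_over_rho f r t
     + (1 + r ^+ 2) * r * drho f r t)
  + r ^+ 2 * dtheta (dtheta f) r t.

End HalfPlane.

(* Main.v *)
Require Import Defs.
From mathcomp Require Import all_boot all_order all_algebra.
From mathcomp Require Import complex ring lra.
From mathcomp Require Import all_classical all_reals all_analysis.
Import Order.TTheory GRing.Theory Num.Theory.
Import numFieldNormedType.Exports.
Local Open Scope classical_set_scope.
Local Open Scope ring_scope.
Local Open Scope complex_scope.

Set Implicit Arguments.
Unset Strict Implicit.
Unset Printing Implicit Defensive.

(* Extended constantly along rays, f o psi becomes the function
   G z = f (|z'| / |z_(n+1)|) (arg z_(n+1)) on the cone z_(n+1) <> 0, with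
   z' = (z_1, .., z_n).  Its Wirtinger derivatives follow from the chain rule.
   As df/drho vanishes on the boundary, f extends differentiably to negative rho
   by f(-rho, theta) = f(rho, theta), which makes the chain rule available at
   z' = 0, where |z'| is not differentiable but is, along a line, the absolute
   value of a smooth function.  This applies to df/dtheta as well, because mixed
   partials commute at the boundary.  The remaining term
   conj(z_j) * (1/rho) df/drho is differentiable at z' = 0 because its first
   factor vanishes there.  Since G is real, T_j (Tbar_j G) and Tbar_j (T_j G) are
   conjugate, so the sub-Laplacian of G is 4 Re (sum_j Tbar_j (T_j G)). *)

(** The angle supplied by [psi] is an arbitrary representative and may jump by multiples of 2 pi, so
    no continuity of it is available. All derivatives are therefore taken along single coordinate
    lines, where the angle is traded for a differentiable argument built from [atan]; periodicity of
    the coefficient functions makes the exchange harmless. The chain rule can be iterated because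
    every T_k G is again a polynomial in coordinates, their conjugates and 1 / |z_(n+1)|^2 or 1 /
    z_(n+1), with coefficients that are functions of (rho, theta): (1/rho) df/drho for k <= n, rho
    df/drho for the last coordinate, and df/dtheta for both. Formulas with |z'|^2 in a denominator
    are used at z' = 0 as well: a quotient by 0 is 0, and the accompanying factor (a coordinate of
    z', or a difference that vanishes at rho = 0) has to be 0 there too. *)

(** * Mean values and a two-variable chain rule *)

Section RealCalculus.
Context {R : realType}.
Implicit Types (f g : R -> R) (h : R -> R -> R).

Lemma mean_value f (df : R -> R) (a b : R) :
  (forall x : R, is_derive x 1 f (df x)) ->
  exists2 c, `|c - a| <= `|b - a| & f b - f a = df c * (b - a).
Proof.
move=> fdf.
have cf : continuous f.
  by move=> x; apply/differentiable_continuous/derivable1_diffP; case: (fdf x).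
have [ab|/ltW ba] := leP a b.
  have [c] := MVT_segment ab (fun x _ => fdf x) (continuous_subspaceT cf).
  rewrite in_itv/= => /andP[ac cb] E; exists c => //.
  by rewrite !ger0_norm ?subr_ge0//; lra.
have [c] := MVT_segment ba (fun x _ => fdf x) (continuous_subspaceT cf).
rewrite in_itv/= => /andP[ac cb] E; exists c; last by lra.
by rewrite !ler0_norm ?subr_le0//; lra.
Qed.

(** The increment splits into a move in the second variable, handled by the mean value theorem, and
    a move in the first with the second frozen at [th s]. Hence continuity is asked only of the
    partial derivative in the second variable. *)
Lemma is_derive_chain2 h (r th : R -> R) (s A B r' th' : R) :
  is_derive (r s) 1 (fun x => h x (th s)) A ->
  (forall x t, derivable (h x) t 1) ->
  {for (r s, th s), continuous (fun p => dtheta h p.1 p.2)} ->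
  dtheta h (r s) (th s) = B ->
  is_derive s 1 r r' -> is_derive s 1 th th' ->
  is_derive s 1 (fun x => h (r x) (th x)) (A * r' + B * th').
Proof.
move=> hA dh cB BE dr dth.
have cr : {for s, continuous r}.
  by apply/differentiable_continuous/derivable1_diffP; case: dr.
have cth : {for s, continuous th}.
  by apply/differentiable_continuous/derivable1_diffP; case: dth.
have /choice[xi xiP] x : exists c, `|c - th s| <= `|th x - th s| /\
    h (r x) (th x) - h (r x) (th s) = dtheta h (r x) c * (th x - th s).
  have [|c c1 c2] := @mean_value (h (r x)) (derive1 (h (r x))) (th s) (th x).
    by move=> y; rewrite derive1E; exact/derivableP.
  by exists c.
have xis : xi s = th s.
  have [+ _] := xiP s; rewrite subrr normr0 normr_le0 subr_eq0.
  by move/eqP.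
(* The intermediate point lies no farther from [th s] than [th x], so it tends to [th s]. *)
have cxi : {for s, continuous xi}.
  rewrite /prop_for /continuous_at xis.
  apply/cvgrPdist_lt => e e0.
  move/cvgrPdist_lt : cth => /(_ e e0); apply: filterS => x.
  rewrite distrC => xe; rewrite distrC; apply: le_lt_trans xe.
  by have [] := xiP x.
have /is_derive1_caratheodory[k [kE ck ks]] := dth.
have /is_derive1_caratheodory[l [lE cl ls]] :
    is_derive s 1 (fun x => h (r x) (th s)) (A * r').
  exact: (is_derive1_comp (f := fun y => h y (th s))).
apply/is_derive1_caratheodory.
exists (fun x => l x + dtheta h (r x) (xi x) * k x); split.
- move=> x; rewrite mulrDl -mulrA -lE -kE -(xiP x).2; lra.
- apply: (@continuousD _ R^o); first exact: cl.
  apply: continuousM; last exact: ck.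
  have cxi' : xi x @[x --> s] --> th s by rewrite -xis; exact: cxi.
  rewrite /prop_for /continuous_at xis.
  exact: (cvg_comp2 (h := dtheta h) (cr : r x @[x --> s] --> r s) cxi' cB).
- by rewrite ls ks xis BE.
Qed.

End RealCalculus.

(** * One-sided derivatives in rho and even extension across the boundary *)

Section HalfPlaneCalculus.
Context {R : realType}.
Implicit Types (h : R -> R -> R).

Lemma is_derive_quotP (f : R -> R) (x a : R) :
  is_derive x 1 f a <-> (fun k => k^-1 * (f (x + k) - f x)) @ 0^' --> a.
Proof.
pose q (k : R) := k^-1 *: ((f \o shift x) (k *: 1) - f x).
have qE : (fun k => k^-1 * (f (x + k) - f x)) = q.
  by apply/funext => k; rewrite /q /= [k *: 1]mulr1 (addrC k).
rewrite qE; split=> [[dq <-]|qa].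
  exact: dq.
have dq : derivable f x 1 by apply/cvg_ex; exists a.
by apply: DeriveDef => //; exact: cvg_lim.
Qed.

Lemma rho_nbhsE (r : R) : 0 < r -> rho_nbhs r = 0^'.
Proof.
move=> r0; apply/seteqP; split => P; rewrite /rho_nbhs /within/=.
  move=> H; near=> x; apply: (near H x) => //=.
  suff : `|x| < r by rewrite ltr_norml => /andP[]; lra.
  near: x; apply: dnbhs0_lt => //.
by apply: filterS => x.
Unshelve. all: by end_near. Qed.

Lemma at_right_rho_nbhs (r : R) : 0 <= r -> 0^'+ `=>` rho_nbhs r.
Proof.
move=> r0 P [e /= e0 He]; exists e => //= x /= xe x0.
by apply: He => //=; [rewrite gt_eqF|rewrite addr_ge0// ltW].
Qed.

Lemma rho_nbhs_proper (r : R) : 0 <= r -> ProperFilter (rho_nbhs r).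
Proof.
move=> r0; split; last exact: within_filter.
move=> H; have := at_right_rho_nbhs r0 H.
exact: (@filter_not_empty _ (0^'+)).
Qed.

Lemma drho_eq h (r t a : R) : 0 <= r ->
  drho_quot h r t @ rho_nbhs r --> a -> drho h r t = a.
Proof.
by move=> r0; have ? := rho_nbhs_proper r0; exact: cvg_lim.
Qed.

(* Extending evenly across the boundary turns [drho h 0 t = 0] into an
   ordinary two-sided derivative. *)
Definition even_ext h (r t : R) := h `|r| t.

Lemma is_derive_even_ext h (r t : R) : 0 <= r ->
  cvg (drho_quot h r t @ rho_nbhs r) -> (r = 0 -> drho h r t = 0) ->
  is_derive r 1 (fun x => even_ext h x t) (drho h r t).
Proof.
rewrite le_eqVlt => /predU1P[<-{r}|r0] ch h0; apply/is_derive_quotP.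
  rewrite h0//; apply: norm_cvg0.
  have absr : (fun x : R => `|x|) @ 0^' --> rho_nbhs (0 : R).
    apply: (@cvg_trans _ (0^'+)); last exact: (at_right_rho_nbhs (lexx 0)).
    move=> P [e /= e0 He]; exists e => //= x /= xe x0.
    apply: He => /=; last by rewrite normr_gt0.
    by move: xe; rewrite !sub0r !normrN normr_id.
  (* At 0 the quotient of the even extension at x has the absolute value of the one-sided quotient
     at |x|, whose limit is 0. *)
  have := cvg_norm (cvg_comp _ _ absr ch).
  rewrite -/(drho h 0 t) h0// normr0 => /(_ (dnbhs_filter _)) H; apply: cvg_trans H.
  apply: near_eq_cvg; near=> x => /=.
  by rewrite /drho_quot /even_ext !add0r normr0 !normrM !normfV normr_id.
move: ch; rewrite rho_nbhsE// => ch.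
suff -> : drho h r t = lim (drho_quot h r t @ 0^').
  apply: cvg_trans ch; apply: near_eq_cvg; near=> x.
  rewrite /drho_quot /even_ext !ger0_norm//; first exact: ltW.
  suff : `|x| < r by rewrite ltr_norml => /andP[]; lra.
  by near: x; apply: dnbhs0_lt.
by rewrite /drho rho_nbhsE.
Unshelve. all: by end_near. Qed.

Lemma continuous_even_ext h :
  {within [set p : R * R | 0 <= p.1], continuous (fun p => h p.1 p.2)} ->
  continuous (fun p : R * R => even_ext h p.1 p.2).
Proof.
move/subspace_continuousP => ch p.
have c : (fun q : R * R => (`|q.1|, q.2)) q @[q --> p] --> (`|p.1|, p.2).
  have c1 : `|q.1| @[q --> p] --> `|p.1| by apply: cvg_norm; exact: cvg_fst.
  have c2 : q.2 @[q --> p] --> p.2 by exact: cvg_snd.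
  exact: (cvg_pair c1 c2).
have c' : (fun q : R * R => (`|q.1|, q.2)) q @[q --> p] -->
    within [set q : R * R | 0 <= q.1] (nbhs (`|p.1|, p.2)).
  move=> P HP.
  have HP' : nbhs p [set q | 0 <= `|q.1| -> P (`|q.1|, q.2)] := c _ HP.
  change (nbhs p [set q | P (`|q.1|, q.2)]).
  by apply: filterS HP' => q; apply; exact: (normr_ge0 q.1).
exact: (cvg_comp _ _ c' (ch (`|p.1|, p.2) (normr_ge0 _))).
Qed.

Lemma dtheta_even_ext h : dtheta (even_ext h) = even_ext (dtheta h).
Proof. by []. Qed.

(** Differentiability in rho is kept out and asked pointwise where needed, so that 1/rho, which has
    no rho-derivative at the boundary, is covered too. *)
Definition theta_smooth h :=
  [/\ forall r t : R, 0 <= r -> derivable (h r) t 1,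
      {within [set p : R * R | 0 <= p.1],
         continuous (fun p => dtheta h p.1 p.2)}
    & forall r t : R, 0 <= r -> h r (t + 2 * pi) = h r t].

Lemma is_derive_even_chain h (r th : R -> R) (s r' th' : R) :
  theta_smooth h -> 0 <= r s ->
  cvg (drho_quot h (r s) (th s) @ rho_nbhs (r s)) ->
  (r s = 0 -> drho h (r s) (th s) = 0) ->
  is_derive s 1 r r' -> is_derive s 1 th th' ->
  is_derive s 1 (fun x => h `|r x| (th x))
    (drho h (r s) (th s) * r' + dtheta h (r s) (th s) * th').
Proof.
move=> [dh ch _] r0 cq h0 dr dth.
apply: (is_derive_chain2 (h := even_ext h)).
- exact: is_derive_even_ext.
- by move=> x t; exact: dh.
- exact: (continuous_even_ext ch).
- by rewrite dtheta_even_ext /even_ext ger0_norm.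
Qed.

(* Schwarz's theorem at the boundary, where [drho h] and with it its derivative
   in [t] vanish. *)
Lemma drho_dtheta_cvg h (t : R) :
  (forall r t : R, 0 <= r -> cvg (drho_quot h r t @ rho_nbhs r)) ->
  (forall t, drho h 0 t = 0) ->
  (forall r t : R, 0 <= r -> derivable (h r) t 1) ->
  (forall r t : R, 0 <= r -> derivable (drho h r) t 1) ->
  {within [set p : R * R | 0 <= p.1],
     continuous (fun p => dtheta (drho h) p.1 p.2)} ->
  drho_quot (dtheta h) 0 t @ rho_nbhs 0 --> (0 : R).
Proof.
move=> ch h0 dh drh ck.
have K0 : dtheta (drho h) 0 t = 0.
  rewrite /dtheta (_ : drho h 0 = cst 0) ?derive1_cst//.
  by apply/funext => x; rewrite h0.
have rp := rho_nbhs_proper (lexx (0 : R)).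
apply/cvgr0Pnorm_le => e e0.
have /cvgrPdist_le/(_ e e0) := @continuous_even_ext _ ck (0, t).
rewrite /= /even_ext normr0 K0 => -[[A B] /= [[d1 /= d10 HA] [d2 /= d20 HB]] AB].
(* Mean values in rho and then in theta express the double difference as r k times the mixed
   derivative at a point near (0, t), where continuity makes it at most e in absolute value. *)
have bound (r k : R) : 0 < r -> r < d1 -> `|k| < d2 ->
    `|(h r (t + k) - h 0 (t + k)) - (h r t - h 0 t)| <= r * e * `|k|.
  move=> r0 rd kd.
  pose g x := even_ext h x (t + k) - even_ext h x t.
  have dg (x : R) : 0 <= x -> is_derive x 1 g (drho h x (t + k) - drho h x t).
    move=> x0; apply: is_deriveB; apply: is_derive_even_ext => //;
      by [exact: ch|move=> ->].
  have cg : {within `[0, r], continuous g}.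
    apply: continuous_in_subspaceT => x; rewrite inE/= in_itv/= => /andP[x0 _].
    by apply/differentiable_continuous/derivable1_diffP; case: (dg x x0).
  have dg' x : x \in `]0, r[ -> is_derive x 1 g (drho h x (t + k) - drho h x t).
    by rewrite in_itv/= => /andP[x0 _]; apply: dg; exact: ltW.
  have [x] := MVT_segment (ltW r0) dg' cg.
  rewrite in_itv/= => /andP[x0 xr]; rewrite /g /even_ext normr0 (ger0_norm (ltW r0)).
  move=> gE; rewrite (_ : _ - _ = (drho h x (t + k) - drho h x t) * r); last by lra.
  have [|c ct ->] := @mean_value _ (drho h x) (derive1 (drho h x)) t (t + k).
    by move=> y; rewrite derive1E; exact/derivableP/drh.
  rewrite (_ : t + k - t = k) in ct *; last by lra.
  have := AB (x, c); rewrite /= sub0r normrN (ger0_norm x0) => H.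
  rewrite (_ : r * e * `|k| = e * `|k| * r); last by ring.
  rewrite !normrM (ger0_norm (ltW r0)) ler_pM2r// ler_wpM2r//; apply: H; split.
    by apply: HA; rewrite /= sub0r normrN ger0_norm//; lra.
  by apply: HB; rewrite /= distrC; exact: le_lt_trans kd.
rewrite /rho_nbhs near_withinE; near=> r => /= r0.
rewrite /drho_quot !add0r in r0 *.
have rn0 : r != 0 by near: r; exact: nbhs_dnbhs_neq.
have {rn0}r0 : 0 < r by rewrite lt0r rn0.
have rd : r < d1.
  by rewrite (le_lt_trans (ler_norm _))//; near: r; apply: dnbhs0_lt.
rewrite normrM normfV (gtr0_norm r0) (ler_pdivrMl _ _ r0).
have D : is_derive t 1 (fun x => h r x - h 0 x) (dtheta h r t - dtheta h 0 t).
  rewrite /dtheta !derive1E; apply: is_deriveB; apply/derivableP/dh => //.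
  exact: ltW.
have /is_derive_quotP/cvg_norm D' := D.
(* Dividing the bound on the double difference by k and letting k tend to 0 leaves r e. *)
apply: (cvgr_to_le D'); near=> k.
have k0 : k != 0 by near: k; exact: nbhs_dnbhs_neq.
rewrite normrM normfV ler_pdivrMl ?normr_gt0// mulrC.
by apply: bound => //; near: k; apply: dnbhs0_lt.
Unshelve. all: by end_near. Qed.

End HalfPlaneCalculus.

Lemma is_derive_ext (R : realType) (f g : R -> R) (x a b : R) :
  is_derive x 1 f a -> f =1 g -> a = b -> is_derive x 1 g b.
Proof. by move=> df /funext <- <-. Qed.

(** * Differentiation at 0 of complex-valued curves *)

Section ComplexDerivative.
Context {R : realType}.
Implicit Types (c u : R -> R[i]) (d e : R[i]).

Definition is_cder c d :=
  is_derive (0 : R) 1 (@complex.Re R \o c) (complex.Re d) /\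
  is_derive (0 : R) 1 (@complex.Im R \o c) (complex.Im d).

Lemma is_cderE c d : is_cder c d -> cderivable c 0 /\ cderive1 c 0 = d.
Proof.
move=> [[r1 r2] [i1 i2]]; split; first exact: (conj r1 i1).
by rewrite /cderive1 !derive1E r2 i2; case: d {r2 i2}.
Qed.

Lemma is_cder_eq c d e : is_cder c d -> d = e -> is_cder c e.
Proof. by move=> ? <-. Qed.

Lemma is_cder_near c u d : (\forall t \near (0 : R), c t = u t) ->
  is_cder c d -> is_cder u d.
Proof.
move=> cu [dr di]; split.
  by apply: near_eq_is_derive dr; apply: filterS cu => t /= ->.
by apply: near_eq_is_derive di; apply: filterS cu => t /= ->.
Qed.

Lemma is_cder_real (u : R -> R) (a : R) :
  is_derive (0 : R) 1 u a -> is_cder (fun t => (u t)%:C) a%:C.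
Proof.
move=> du; split; first exact: du.
by rewrite (_ : _ \o _ = cst 0)//; exact: is_derive_cst.
Qed.

Lemma is_cder_cst d : is_cder (cst d) 0.
Proof. by split; exact: is_derive_cst. Qed.

Lemma is_cderD c u d e : is_cder c d -> is_cder u e ->
  is_cder (fun t => c t + u t) (d + e).
Proof.
move=> [cr ci] [ur ui].
split.
  apply: (is_derive_ext (is_deriveD cr ur)) => [t|]; rewrite ?fctE/=.
    by case: (c t) (u t) => ? ? [].
  by case: d e {cr ci ur ui} => ? ? [].
apply: (is_derive_ext (is_deriveD ci ui)) => [t|]; rewrite ?fctE/=.
  by case: (c t) (u t) => ? ? [].
by case: d e {cr ci ur ui} => ? ? [].
Qed.

Lemma is_cderM c u d e : is_cder c d -> is_cder u e ->
  is_cder (fun t => c t * u t) (d * u 0 + c 0 * e).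
Proof.
move=> [cr ci] [ur ui].
split.
  apply: (is_derive_ext (is_deriveB (is_deriveM cr ur) (is_deriveM ci ui))) => [t|].
    by rewrite !fctE/=; case: (c t) (u t) => ? ? [].
  rewrite /GRing.scale/=.
  case: d e (c 0) (u 0) {cr ci ur ui} => ? ? [? ?] [? ?] [? ?] /=; ring.
apply: (is_derive_ext (is_deriveD (is_deriveM cr ui) (is_deriveM ci ur))) => [t|].
  by rewrite !fctE/=; case: (c t) (u t) => ? ? [].
rewrite /GRing.scale/=.
case: d e (c 0) (u 0) {cr ci ur ui} => ? ? [? ?] [? ?] [? ?] /=; ring.
Qed.

Lemma is_cder_conj c d : is_cder c d -> is_cder (fun t => (c t)^*%C) d^*%C.
Proof.
move=> [cr ci]; split.
  apply: (is_derive_ext cr) => [t|] /=; first by case: (c t).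
  by case: d {cr ci}.
apply: (is_derive_ext (is_deriveN ci)) => [t|]; rewrite ?fctE/=.
  by case: (c t).
by case: d {cr ci}.
Qed.

Lemma is_cder_neq0 c d : is_cder c d -> c 0 != 0 ->
  \forall t \near (0 : R), c t != 0.
Proof.
move=> [[cr _] [ci _]] c0.
have {}cr : {for 0, continuous (@complex.Re R \o c)}.
  apply/differentiable_continuous/derivable1_diffP; exact: cr.
have {}ci : {for 0, continuous (@complex.Im R \o c)}.
  apply/differentiable_continuous/derivable1_diffP; exact: ci.
have [r0|r0] := eqVneq (complex.Re (c 0)) 0; last first.
  apply: filterS (cvgr_neq0 _ cr r0) => t.
  by apply: contra_neq => /= ->.
have i0 : complex.Im (c 0) != 0.
  by apply: contra_neq c0 => i0; apply/eqP; rewrite eq_complex r0 i0/= eqxx.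
apply: filterS (cvgr_neq0 _ ci i0) => t.
by apply: contra_neq => /= ->.
Qed.

Lemma is_cderV c d : is_cder c d -> c 0 != 0 ->
  is_cder (fun t => (c t)^-1) (- d / c 0 ^+ 2).
Proof.
move=> [cr ci] c0.
have n0 : complex.Re (c 0) ^+ 2 + complex.Im (c 0) ^+ 2 != 0.
  apply: contra c0; rewrite paddr_eq0 ?sqr_ge0// !sqrf_eq0 eq_complex.
  by case: (c 0).
have dn := is_deriveV (f := (@complex.Re R \o c) ^+ 2 + (@complex.Im R \o c) ^+ 2)
  n0 (is_deriveD (is_deriveX 2 cr) (is_deriveX 2 ci)).
split.
  apply: (is_derive_ext (is_deriveM cr dn)) => [t|].
    by rewrite !fctE/=; case: (c t).
  rewrite /GRing.scale/= !fctE/= expr1.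
  case: (c 0) d n0 {cr ci dn c0} => x y [dx dy] /= n0.
  (* The left side is |c^2|^2, coming from the division by [c 0 ^+ 2]; written as |c|^4 it is
     visibly nonzero for [field]. *)
  have -> : (x * x - y * y) ^+ 2 + (x * y + y * x) ^+ 2 = (x ^+ 2 + y ^+ 2) ^+ 2
    by ring.
  by field.
apply: (is_derive_ext (is_deriveN (is_deriveM ci dn))) => [t|].
  by rewrite !fctE/=; case: (c t).
rewrite /GRing.scale/= !fctE/= expr1.
case: (c 0) d n0 {cr ci dn c0} => x y [dx dy] /= n0.
have -> : (x * x - y * y) ^+ 2 + (x * y + y * x) ^+ 2 = (x ^+ 2 + y ^+ 2) ^+ 2
  by ring.
by field.
Qed.

End ComplexDerivative.

(** * Rules for Wirtinger derivatives *)

Section WirtingerRules.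
Context {R : realType} {m : nat}.
Implicit Types (F G : 'rV[R[i]]_m -> R[i]) (z : 'rV[R[i]]_m) (a b : 'I_m -> R[i]).

(** The coordinatewise real-linear differential a_k c + b_k conj(c), with a_k = dF/dz_k and b_k =
    dF/dzbar_k. Treating a general direction c handles the x-lines (c = 1) and the y-lines (c = i)
    in one computation. *)
Definition has_dz F z a b := forall k (c : R[i]),
  is_cder (fun t => F (z + (t%:C * c) *: delta_mx 0 k)) (a k * c + b k * c^*%C).

Lemma line0 z k (c : R[i]) : z + ((0 : R)%:C * c) *: delta_mx 0 k = z.
Proof. by rewrite mul0r scale0r addr0. Qed.

Lemma has_dz_x F z a b k : has_dz F z a b ->
  is_cder (xline k F z) (a k + b k).
Proof.
move=> /(_ k 1) H.
have -> : xline k F z = fun t => F (z + (t%:C * 1) *: delta_mx 0 k).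
  by apply/funext => t; rewrite /xline mulr1.
by apply: is_cder_eq H _; rewrite conjc1 !mulr1.
Qed.

Lemma has_dz_y F z a b k : has_dz F z a b ->
  is_cder (yline k F z) ('i%C * (a k - b k)).
Proof.
move=> /(_ k 'i%C) H.
have -> : yline k F z = fun t => F (z + (t%:C * 'i%C) *: delta_mx 0 k).
  by apply/funext => t; rewrite /yline mulrC.
apply: is_cder_eq H _.
have -> : 'i%C^*%C = - 'i%C :> R[i] by simpc.
ring.
Qed.

Lemma has_dz_pderivable F z a b : has_dz F z a b -> pderivable F z.
Proof.
move=> H k; split; first exact: (is_cderE (has_dz_x k H)).1.
exact: (is_cderE (has_dz_y k H)).1.
Qed.

Lemma has_dzE F z a b k : has_dz F z a b -> dz k F z = a k.
Proof.
move=> H; rewrite /dz /dx /dy (is_cderE (has_dz_x k H)).2.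
rewrite (is_cderE (has_dz_y k H)).2 mulrA -expr2 sqr_i.
by field.
Qed.

Lemma has_dzbarE F z a b k : has_dz F z a b -> dzbar k F z = b k.
Proof.
move=> H; rewrite /dzbar /dx /dy (is_cderE (has_dz_x k H)).2.
rewrite (is_cderE (has_dz_y k H)).2 mulrA -expr2 sqr_i.
by field.
Qed.

Lemma has_dz_eq F z a b a' b' : has_dz F z a b -> a =1 a' -> b =1 b' ->
  has_dz F z a' b'.
Proof. by move=> H /funext <- /funext <-. Qed.

Lemma has_dz_cst (d : R[i]) z : has_dz (cst d) z (cst 0) (cst 0).
Proof. by move=> k c; rewrite !mul0r addr0; exact: is_cder_cst. Qed.

Lemma has_dz_coord j z :
  has_dz (fun z => z 0 j) z (fun k => (k == j)%:R) (cst 0).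
Proof.
move=> k c; rewrite mul0r addr0 mulrC.
apply: is_cder_eq; first under eq_fun do rewrite !mxE eqxx/= eq_sym.
  apply: is_cderD; first exact: is_cder_cst.
  apply: is_cderM; last exact: is_cder_cst.
  apply: is_cderM; last exact: is_cder_cst.
  by apply: is_cder_real; exact: is_derive_id.
by rewrite /cst/= !mulr0 !addr0 add0r mul1r.
Qed.

Lemma has_dzD F G z a b a' b' : has_dz F z a b -> has_dz G z a' b' ->
  has_dz (fun z => F z + G z) z (fun k => a k + a' k) (fun k => b k + b' k).
Proof.
move=> FH GH k c; apply: is_cder_eq (is_cderD (FH k c) (GH k c)) _; ring.
Qed.

Lemma has_dzM F G z a b a' b' : has_dz F z a b -> has_dz G z a' b' ->
  has_dz (fun z => F z * G z) z (fun k => a k * G z + F z * a' k)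
                                (fun k => b k * G z + F z * b' k).
Proof.
move=> FH GH k c; apply: is_cder_eq (is_cderM (FH k c) (GH k c)) _.
rewrite line0; ring.
Qed.

Lemma has_dz_conj F z a b : has_dz F z a b ->
  has_dz (fun z => (F z)^*%C) z (fun k => (b k)^*%C) (fun k => (a k)^*%C).
Proof.
move=> FH k c; apply: is_cder_eq (is_cder_conj (FH k c)) _.
by rewrite rmorphD !rmorphM/= conjcK addrC.
Qed.

Lemma has_dzV F z a b : F z != 0 -> has_dz F z a b ->
  has_dz (fun z => (F z)^-1) z (fun k => - a k / F z ^+ 2)
                               (fun k => - b k / F z ^+ 2).
Proof.
move=> F0 FH k c; apply: is_cder_eq (is_cderV (FH k c) _) _; rewrite line0//.
ring.
Qed.

Lemma has_dz_near F G z a b :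
  (forall k (c : R[i]), \forall t \near (0 : R),
     F (z + (t%:C * c) *: delta_mx 0 k) = G (z + (t%:C * c) *: delta_mx 0 k)) ->
  has_dz F z a b -> has_dz G z a b.
Proof. by move=> FG FH k c; apply: is_cder_near (FH k c). Qed.

Lemma has_dz_neq0 F z a b : has_dz F z a b -> F z != 0 ->
  forall k (c : R[i]), \forall t \near (0 : R),
    F (z + (t%:C * c) *: delta_mx 0 k) != 0.
Proof. by move=> FH F0 k c; apply: is_cder_neq0 (FH k c) _; rewrite line0. Qed.

End WirtingerRules.

(** * The coefficient functions of (rho, theta) and their regularity *)

Section RadialCoefficients.
Context {R : realType}.
Implicit Types h : R -> R -> R.

Lemma theta_smoothP h : Ck_half 1 h ->
  (forall r t : R, 0 <= r -> h r (t + 2 * pi) = h r t) -> theta_smooth h.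
Proof. by move=> [_ [_ dh _ [ch _]]] ph; split. Qed.

Lemma dtheta_periodic h (r t : R) : 0 <= r ->
  (forall r t : R, 0 <= r -> h r (t + 2 * pi) = h r t) ->
  dtheta h r (t + 2 * pi) = dtheta h r t.
Proof.
move=> r0 ph; pose q s (k : R) := k^-1 *: (h r (k + s) - h r s).
have E : q (t + 2 * pi) = q t by apply/funext => k; rewrite /q addrA !ph.
exact: (congr1 (fun u : R -> R => lim (u @ 0^')) E).
Qed.

Lemma drho_periodic h (r t : R) : 0 <= r ->
  (forall r t : R, 0 <= r -> h r (t + 2 * pi) = h r t) ->
  cvg (drho_quot h r t @ rho_nbhs r) ->
  drho h r (t + 2 * pi) = drho h r t.
Proof.
move=> r0 ph ch; apply: drho_eq => //.
have ? := rho_nbhs_proper r0.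
apply: cvg_trans ch; apply: near_eq_cvg.
rewrite /rho_nbhs near_withinE; near=> k => /= rk.
by rewrite /drho_quot !ph.
Unshelve. all: by end_near. Qed.

Definition rho_mul h (r t : R) : R := r * h r t.

Lemma dtheta_rho_mul h (r t : R) : derivable (h r) t 1 ->
  dtheta (rho_mul h) r t = r * dtheta h r t.
Proof.
move=> dh; rewrite /dtheta !derive1E.
by have [_ ->] := is_deriveZ r (derivableP dh).
Qed.

Lemma theta_smooth_rho_mul h : theta_smooth h -> theta_smooth (rho_mul h).
Proof.
move=> [dh ch ph]; split.
- by move=> r t r0; exact: (derivableZ (k := r) (dh r t r0)).
- have E : {in [set p : R * R | 0 <= p.1], (fun p : R * R => p.1 * dtheta h p.1 p.2)
            =1 (fun p => dtheta (rho_mul h) p.1 p.2)}.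
    by move=> p; rewrite inE/= => p0; rewrite dtheta_rho_mul//; exact: dh.
  apply: (subspace_eq_continuous E).
  move=> p; apply: continuousM; last exact: ch.
  by apply: continuous_subspaceT => q; exact: cvg_fst.
- by move=> r t r0; rewrite /rho_mul ph.
Qed.

Lemma drho_quot_rho_mul h (r t : R) : 0 <= r ->
  cvg (drho_quot h r t @ rho_nbhs r) ->
  drho_quot (rho_mul h) r t @ rho_nbhs r --> h r t + r * drho h r t.
Proof.
move=> r0 ch; have ? := rho_nbhs_proper r0.
have k0 : (fun k : R => k) @ rho_nbhs r --> (0 : R).
  by apply: cvg_within_filter; exact: cvg_within.
have FF : Filter (rho_nbhs r) by exact: within_filter.
have /(_ FF FF FF FF FF) H := cvgD (cvg_cst (h r t)) (cvgM (cvgD (cvg_cst r) k0) ch).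
rewrite (addr0 r) in H; apply: cvg_trans H; apply: near_eq_cvg.
rewrite /rho_nbhs near_withinE; near=> k => /= rk.
have k1 : k != 0 by near: k; exact: nbhs_dnbhs_neq.
rewrite /drho_quot /rho_mul !fctE/=.
by field.
Unshelve. all: by end_near. Qed.

Definition rho_inv (r t : R) : R := r^-1.

Lemma dtheta_rho_inv (r t : R) : dtheta rho_inv r t = 0.
Proof. by rewrite /dtheta derive1_cst. Qed.

Lemma theta_smooth_rho_inv : theta_smooth rho_inv.
Proof.
split; last by [].
  by move=> r t _; exact: (derivable_cst (r^-1) t 1).
rewrite (_ : (fun p => _) = cst (0 : R)).
  by apply: continuous_subspaceT => q; exact: cvg_cst.
by apply/funext => p; rewrite dtheta_rho_inv.
Qed.

Lemma drho_quot_rho_inv (r t : R) : 0 < r ->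
  drho_quot rho_inv r t @ rho_nbhs r --> - r ^- 2.
Proof.
move=> r0; rewrite rho_nbhsE//; apply/is_derive_quotP.
have H := is_deriveV (f := id) (lt0r_neq0 r0) (is_derive_id r (1 : R)).
by apply: (is_derive_ext H) => //; exact: mulr1.
Qed.

Section InD.
Variables (f : R -> R -> R) (hf : in_D f).

Let Cf k : Ck_half k f. Proof. by case: hf => _ /(_ k). Qed.
Let Cr k : Ck_half k (drho f). Proof. by case: (Cf k.+1) => _ []. Qed.
Let Ct k : Ck_half k (dtheta f). Proof. by case: (Cf k.+1) => _ []. Qed.

Lemma in_D_cvg (r t : R) : 0 <= r -> cvg (drho_quot f r t @ rho_nbhs r).
Proof. by case: (Cf 1) => _ [+ _ _ _]; exact. Qed.

Lemma in_D_cvg_drho (r t : R) : 0 <= r ->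
  cvg (drho_quot (drho f) r t @ rho_nbhs r).
Proof. by case: (Cr 1) => _ [+ _ _ _]; exact. Qed.

Lemma in_D_cvg_dtheta (r t : R) : 0 <= r ->
  cvg (drho_quot (dtheta f) r t @ rho_nbhs r).
Proof. by case: (Ct 1) => _ [+ _ _ _]; exact. Qed.

Lemma in_D_theta_smooth : theta_smooth f.
Proof. by apply: theta_smoothP (Cf 1) _; case: hf. Qed.

Lemma in_D_theta_smooth_drho : theta_smooth (drho f).
Proof.
apply: theta_smoothP (Cr 1) _ => r t r0; case: hf => pf _ _.
by apply: drho_periodic => //; exact: in_D_cvg.
Qed.

Lemma in_D_theta_smooth_dtheta : theta_smooth (dtheta f).
Proof.
apply: theta_smoothP (Ct 1) _ => r t r0; case: hf => pf _ _.
exact: dtheta_periodic.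
Qed.

Lemma in_D_drho0 t : drho f 0 t = 0.
Proof. by case: hf. Qed.

Lemma in_D_drho_dtheta0 t : drho (dtheta f) 0 t = 0.
Proof.
apply: drho_eq => //; apply: drho_dtheta_cvg.
- exact: in_D_cvg.
- exact: in_D_drho0.
- by case: in_D_theta_smooth.
- by case: in_D_theta_smooth_drho.
- by case: in_D_theta_smooth_drho.
Qed.

End InD.
End RadialCoefficients.

(** * Moduli and arguments of complex numbers *)

Section ComplexPolar.
Context {R : realType}.
Implicit Types (c d : R[i]) (s t x y : R).

Definition sqmod c : R := complex.Re c ^+ 2 + complex.Im c ^+ 2.

Lemma sqmod_ge0 c : 0 <= sqmod c.
Proof. by rewrite addr_ge0 ?sqr_ge0. Qed.

Lemma sqmod_eq0 c : (sqmod c == 0) = (c == 0).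
Proof.
by rewrite paddr_eq0 ?sqr_ge0// !sqrf_eq0 eq_complex; case: c.
Qed.

Lemma sqmod_gt0 c : (0 < sqmod c) = (c != 0).
Proof. by rewrite lt0r sqmod_ge0 andbT sqmod_eq0. Qed.

Lemma sqmodM c d : sqmod (c * d) = sqmod c * sqmod d.
Proof. by case: c d => a b [a' b']; rewrite /sqmod/=; ring. Qed.

Lemma sqmodE c : (sqmod c)%:C = c * c^*%C.
Proof. by case: c => a b; rewrite /sqmod; simpc; congr (_ +i* _); ring. Qed.

Lemma sqmod_line c d t :
  sqmod (c + t%:C * d) = sqmod c + t * (2 * complex.Re (c^*%C * d)) + t ^+ 2 * sqmod d.
Proof. by case: c d => a b [a' b']; rewrite /sqmod/=; ring. Qed.

Lemma expiD s t : expi (s + t) = expi s * expi t.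
Proof.
by rewrite /expi sinD cosD; apply/eqP; rewrite eq_complex/= (addrC (sin s * _)) !eqxx.
Qed.

Definition is_arg c t := c = (Num.sqrt (sqmod c))%:C * expi t.

Lemma is_arg_exists c : exists t, is_arg c t.
Proof.
have [->|c0] := eqVneq c 0.
  by exists 0; rewrite /is_arg /sqmod/= expr0n/= addr0 sqrtr0 mul0r.
have m0 : 0 < Num.sqrt (sqmod c) by rewrite sqrtr_gt0 sqmod_gt0.
set m := Num.sqrt (sqmod c) in m0 *.
have mE : m ^+ 2 = sqmod c by rewrite sqr_sqrtr ?sqmod_ge0.
set x := complex.Re c / m; set y := complex.Im c / m.
have xy : x ^+ 2 + y ^+ 2 = 1.
  by rewrite /x /y !expr_div_n -mulrDl mE divff// sqmod_eq0.
have x1 : -1 <= x <= 1 by have y2 := sqr_ge0 y; apply/andP; split; nra.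
have yE : Num.sqrt (1 - x ^+ 2) = `|y|.
  by rewrite -xy addrAC subrr add0r sqrtr_sqr.
have cE : c = m%:C * (x +i* y).
  by case: (c) @x @y {xy x1 yE} => a b /=; simpc; rewrite !(mulrC m) !divfK ?gt_eqF.
have [y0|y0] := leP 0 y.
  exists (acos x); rewrite /is_arg /expi acosK ?in_itv//= sin_acos// yE ger0_norm//.
exists (- acos x); rewrite /is_arg /expi cosN sinN acosK ?in_itv//= sin_acos// yE ltr0_norm//.
by rewrite opprK.
Qed.

Lemma periodic_int (g : R -> R) (p : R) (k : int) t :
  (forall t, g (t + p) = g t) -> g (t + k%:~R * p) = g t.
Proof.
move=> gp; have H (m : nat) s : g (s + m%:R * p) = g s.
  by rewrite mulr_natl; exact: periodicn.
case: k => m; first exact: H.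
by rewrite -[LHS](H m.+1) NegzE mulrNz mulNr subrK.
Qed.

(** The remainder u of x modulo 2 pi lies in [0, 2 pi). If u were nonzero, then sin (u / 2) > 0,
    against cos u = 1 - 2 sin (u / 2)^2. *)
Lemma cos_eq1 x : cos x = 1 -> exists k : int, x = k%:~R * (2 * pi).
Proof.
have p0 : 0 < 2 * pi :> R by rewrite mulr_gt0 ?pi_gt0.
have cosp t : cos (t + 2 * pi) = cos t :> R by rewrite mulr_natl cosD2pi.
pose k := Num.floor (x / (2 * pi)); pose u := x - k%:~R * (2 * pi).
have xE : x = u + k%:~R * (2 * pi) by rewrite /u subrK.
rewrite {1}xE periodic_int// => u1; exists k.
have /andP[k1 k2] := floor_itv (x / (2 * pi)).
rewrite -/k ler_pdivlMr// in k1; rewrite -/k ltr_pdivrMr// intrD mulrDl mul1r in k2.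
have [u0|u0] := eqVneq u 0; first by rewrite xE u0 add0r.
have up : 0 < u by rewrite lt0r u0 subr_ge0.
have u2 : u / 2 *+ 2 = u by rewrite -mulr_natr divfK.
have := sin_gt0_pi (x := u / 2); have : 0 < u / 2 < pi.
  by apply/andP; split; rewrite /u in up *; lra.
move=> -> /(_ isT) /lt0r_neq0/negP[]; rewrite -sqrf_eq0 sin2cos2.
move: u1; rewrite -{1}u2 cos_mulr2n => u1; apply/eqP; lra.
Qed.

Lemma expi_inj s t : expi s = expi t -> exists k : int, s = t + k%:~R * (2 * pi).
Proof.
move=> [cst sst]; have [|k kE] := @cos_eq1 (s - t).
  by rewrite cosB cst sst -!expr2 cos2Dsin2.
by exists k; rewrite -kE; ring.
Qed.

Lemma is_arg_uniq c s t : c != 0 -> is_arg c s -> is_arg c t ->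
  exists k : int, s = t + k%:~R * (2 * pi).
Proof.
move=> c0 cs; rewrite /is_arg {1}cs => /mulfI st; apply: expi_inj; apply: st.
rewrite (_ : 0 = 0%:C)// (inj_eq (@complexI R)) gt_eqF// sqrtr_gt0.
by rewrite sqmod_gt0.
Qed.

Lemma is_argM c d s t : is_arg c s -> is_arg d t -> is_arg (c * d) (s + t).
Proof.
rewrite /is_arg => cs dt; rewrite sqmodM sqrtrM ?sqmod_ge0// expiD rmorphM/=.
rewrite {1}cs {1}dt; ring.
Qed.

(** A differentiable choice of argument on the right half-plane, meant for numbers close to 1. *)
Lemma is_arg_atan c : 0 < complex.Re c ->
  is_arg c (atan (complex.Im c / complex.Re c)).
Proof.
case: c => x y /= x0.
have cE : cos (atan (y / x)) = x / Num.sqrt (x ^+ 2 + y ^+ 2).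
  rewrite cos_atan.
  have -> : 1 + (y / x) ^+ 2 = (x ^+ 2 + y ^+ 2) / x ^+ 2 by field; rewrite gt_eqF.
  rewrite sqrtrM ?addr_ge0 ?sqr_ge0// sqrtrV ?sqr_ge0// sqrtr_sqr gtr0_norm//.
  by rewrite invfM invrK mulrC.
have c0 : 0 < cos (atan (y / x)).
  by rewrite cE divr_gt0// sqrtr_gt0 ltr_wpDr ?sqr_ge0// exprn_gt0.
have sE : sin (atan (y / x)) = y / Num.sqrt (x ^+ 2 + y ^+ 2).
  have := atanK (y / x); rewrite /tan => /(canRL (divfK (lt0r_neq0 c0))) ->.
  by rewrite cE mulrA divfK ?gt_eqF.
have m0 : Num.sqrt (x ^+ 2 + y ^+ 2) != 0.
  by rewrite gt_eqF// sqrtr_gt0 ltr_wpDr ?sqr_ge0// exprn_gt0.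
rewrite /is_arg /expi cE sE /sqmod/=; simpc.
by rewrite !(mulrC (Num.sqrt _)) !divfK.
Qed.

End ComplexPolar.

(** * The splitting z = (z', z_(n+1)) and its behaviour along coordinate lines *)

Section PolarCoordinates.
Context {R : realType} {n : nat}.
Implicit Types (z : 'rV[R[i]]_(n + 1)) (c : R[i]) (h : R -> R -> R).

Definition sqhead z : R := \sum_(j < n) sqmod (z 0 (lshift 1 j)).

Definition rho z : R := Num.sqrt (sqhead z / sqmod (zlast z)).

Definition coef (T : Type) (u : 'I_n -> T) (v : T) (k : 'I_(n + 1)) : T :=
  if fintype.split k is inl j then u j else v.

Lemma coefL T (u : 'I_n -> T) v j : coef u v (lshift 1 j) = u j.
Proof. by rewrite /coef (unsplitK (inl j)). Qed.

Lemma coefR T (u : 'I_n -> T) v : coef u v (rshift n ord0) = v.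
Proof. by rewrite /coef (unsplitK (inr ord0)). Qed.

Lemma ord_last_ind (P : 'I_(n + 1) -> Prop) :
  (forall j, P (lshift 1 j)) -> P (rshift n ord0) -> forall k, P k.
Proof. by move=> Pl Pr k; case: (split_ordP k) => j ->//; rewrite ord1. Qed.

Lemma sum_last (F : 'I_(n + 1) -> R[i]) :
  \sum_k F k = \sum_(j < n) F (lshift 1 j) + F (rshift n ord0).
Proof. by rewrite big_split_ord/= big_ord1. Qed.

Lemma sqhead_ge0 z : 0 <= sqhead z.
Proof. by apply: sumr_ge0 => j _; exact: sqmod_ge0. Qed.

Lemma sqhead_eq0 z j : sqhead z = 0 -> z 0 (lshift 1 j) = 0.
Proof.
move=> /psumr_eq0P => /(_ (fun i _ => sqmod_ge0 _)) /(_ j isT)/eqP.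
by rewrite sqmod_eq0 => /eqP.
Qed.

Lemma rho_ge0 z : 0 <= rho z.
Proof. exact: sqrtr_ge0. Qed.

Lemma sqr_rho z : rho z ^+ 2 = sqhead z / sqmod (zlast z).
Proof. by rewrite sqr_sqrtr// divr_ge0 ?sqhead_ge0 ?sqmod_ge0. Qed.

Lemma rho_eq0 z : zlast z != 0 -> (rho z == 0) = (sqhead z == 0).
Proof.
move=> z0; rewrite -[LHS]sqrf_eq0 sqr_rho mulf_eq0 invr_eq0 sqmod_eq0.
by rewrite (negPf z0) orbF.
Qed.

Lemma zlast_lineL z j c t : zlast (z + (t%:C * c) *: delta_mx 0 (lshift 1 j)) = zlast z.
Proof. by rewrite /zlast !mxE eq_rlshift andbF mulr0 addr0. Qed.

Lemma zlast_lineR z c t :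
  zlast (z + (t%:C * c) *: delta_mx 0 (rshift n ord0)) = zlast z + t%:C * c.
Proof. by rewrite /zlast !mxE !eqxx mulr1. Qed.

Lemma head_line z k c t j : k != lshift 1 j ->
  (z + (t%:C * c) *: delta_mx 0 k) 0 (lshift 1 j) = z 0 (lshift 1 j).
Proof. by move=> kj; rewrite !mxE eq_sym (negPf kj) andbF mulr0 addr0. Qed.

Lemma sqhead_lineL z j c t :
  sqhead (z + (t%:C * c) *: delta_mx 0 (lshift 1 j)) =
  sqhead z + t * (2 * complex.Re ((z 0 (lshift 1 j))^*%C * c)) + t ^+ 2 * sqmod c.
Proof.
rewrite /sqhead (bigD1 j)//= [in RHS](bigD1 j)//= !mxE !eqxx mulr1 sqmod_line.
rewrite -!addrA; congr (_ + _); rewrite addrC -!addrA.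
rewrite (eq_bigr (fun i => sqmod (z 0 (lshift 1 i)))); first by ring.
by move=> i ij; rewrite head_line// eq_lshift eq_sym.
Qed.

Lemma sqhead_lineR z c t :
  sqhead (z + (t%:C * c) *: delta_mx 0 (rshift n ord0)) = sqhead z.
Proof. by apply: eq_bigr => j _; rewrite head_line// eq_rlshift. Qed.

Lemma has_dz_zlast z : has_dz (@zlast R n) z (coef (cst 0) 1) (cst 0).
Proof.
apply: has_dz_eq (has_dz_coord _ _) _ _ => //.
by apply: ord_last_ind => [j|]; rewrite ?coefL ?coefR ?eqxx// eq_lrshift.
Qed.

Lemma has_dz_cone F G z a b : zlast z != 0 ->
  (forall z, zlast z != 0 -> F z = G z) -> has_dz F z a b -> has_dz G z a b.
Proof.
move=> z0 FG; apply: has_dz_near => k c.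
by apply: filterS (has_dz_neq0 (has_dz_zlast z) z0 k c) => t; exact: FG.
Qed.

Lemma is_derive_quadratic (a b d : R) :
  is_derive (0 : R) 1 (fun t : R => a + t * b + t ^+ 2 * d) b.
Proof.
have H := is_deriveD (is_deriveD (is_derive_cst a (0 : R) (1 : R))
  (is_deriveM (is_derive_id (0 : R) 1) (is_derive_cst b (0 : R) (1 : R))))
  (is_deriveM (is_deriveX 2 (is_derive_id (0 : R) 1)) (is_derive_cst d (0 : R) (1 : R))).
apply: (is_derive_ext H) => //.
rewrite /GRing.scale/= !fctE/= /cst; ring.
Qed.

End PolarCoordinates.

(** * Wirtinger derivatives of functions of (rho, theta) *)

Section PolarFunctions.
Context {R : realType} {n : nat}.
Implicit Types (z : 'rV[R[i]]_(n + 1)) (c : R[i]) (h : R -> R -> R).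
Variable theta : 'rV[R[i]]_(n + 1) -> R.
Hypothesis theta_arg : forall z, zlast z != 0 -> is_arg (zlast z) (theta z).

Definition polar h z : R[i] := (h (rho z) (theta z))%:C.

(** Allows [theta z] to be replaced by any argument of z_(n+1), in particular by one that varies
    differentiably along a line. *)
Lemma theta_smooth_arg h z (r t : R) : theta_smooth h -> 0 <= r ->
  zlast z != 0 -> is_arg (zlast z) t -> h r (theta z) = h r t.
Proof.
move=> [_ _ ph] r0 z0 zt.
have [k ->] := is_arg_uniq z0 (theta_arg z0) zt.
by apply: (periodic_int (g := h r)) => s; exact: ph.
Qed.

Lemma rho_line_sqhead0 z j c t : zlast z != 0 -> sqhead z = 0 ->
  rho (z + (t%:C * c) *: delta_mx 0 (lshift 1 j)) =
  `|t| * Num.sqrt (sqmod c / sqmod (zlast z)).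
Proof.
move=> z0 a0; rewrite /rho sqhead_lineL zlast_lineL a0 (sqhead_eq0 j a0).
rewrite rmorph0 mul0r/= mulr0 mulr0 !add0r -mulrA sqrtrM ?sqr_ge0//.
by rewrite sqrtr_sqr.
Qed.

(** At z' = 0 the signed function t K serves as [r]; elsewhere [rho] itself does. The slope is
    specified only for nonzero [rho z], because at 0 it gets multiplied by a vanishing
    rho-derivative. *)
Lemma rho_lineL z j c : zlast z != 0 -> exists (r : R -> R) (r' : R),
  [/\ r 0 = rho z, is_derive (0 : R) 1 r r',
      forall t, rho (z + (t%:C * c) *: delta_mx 0 (lshift 1 j)) = `|r t|
    & rho z != 0 ->
      r' = rho z / sqhead z * complex.Re ((z 0 (lshift 1 j))^*%C * c)].
Proof.
move=> z0; have b0 : sqmod (zlast z) != 0 by rewrite sqmod_eq0.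
have [a0|a0] := eqVneq (sqhead z) 0.
  have r0 : rho z = 0 by apply/eqP; rewrite rho_eq0// a0.
  pose K := Num.sqrt (sqmod c / sqmod (zlast z)).
  exists (fun t => t * K), K; split.
  - by rewrite mul0r r0.
  - have := is_deriveM (is_derive_id (0 : R) (1 : R)) (is_derive_cst K (0 : R) (1 : R)).
    by move/is_derive_ext; apply => //; rewrite /cst scaler0 add0r; exact: mulr1.
  - by move=> t; rewrite rho_line_sqhead0// normrM (ger0_norm (sqrtr_ge0 _)).
  - by rewrite r0 eqxx.
set D := complex.Re _.
pose q t := (sqhead z + t * (2 * D) + t ^+ 2 * sqmod c) * (sqmod (zlast z))^-1.
have dq : is_derive (0 : R) 1 q (2 * D / sqmod (zlast z)).
  have := is_deriveM (is_derive_quadratic (sqhead z) (2 * D) (sqmod c))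
    (is_derive_cst (sqmod (zlast z))^-1 (0 : R) (1 : R)).
  move/is_derive_ext; apply => //.
  by rewrite /cst scaler0 add0r; exact: mulrC.
have q0 : q 0 = sqhead z / sqmod (zlast z) by rewrite /q !mul0r expr0n/= mul0r !addr0.
have qp : 0 < q 0.
  by rewrite q0 divr_gt0// lt0r ?a0 ?b0 ?sqhead_ge0 ?sqmod_ge0.
have := is_derive1_comp (is_derive1_sqrt qp) dq => dr.
eexists; eexists; split; [|exact: dr| |].
- by rewrite /= q0.
- by move=> t; rewrite /= ger0_norm ?sqrtr_ge0// /rho sqhead_lineL zlast_lineL.
- move=> r0; rewrite q0 -/(rho z).
  have aE : sqhead z = rho z ^+ 2 * sqmod (zlast z) by rewrite sqr_rho divfK.
  rewrite aE; field.
  by rewrite r0 b0.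
Qed.

(** Along this line |z'| is constant and log |z_(n+1) + t c| has derivative Re (c / z_(n+1)) at
    0. *)
Lemma rho_lineR z c : zlast z != 0 -> exists r : R -> R,
  [/\ r 0 = rho z, is_derive (0 : R) 1 r (- rho z * complex.Re (c / zlast z))
    & forall t, rho (z + (t%:C * c) *: delta_mx 0 (rshift n ord0)) = `|r t|].
Proof.
move=> z0; have b0 : 0 < sqmod (zlast z) by rewrite sqmod_gt0.
set D := complex.Re ((zlast z)^*%C * c).
pose q t := sqmod (zlast z) + t * (2 * D) + t ^+ 2 * sqmod c.
have dq : is_derive (0 : R) 1 q (2 * D) by exact: is_derive_quadratic.
have q0 : q 0 = sqmod (zlast z) by rewrite /q !mul0r expr0n/= mul0r !addr0.
have qp : 0 < q 0 by rewrite q0.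
have s0 : Num.sqrt (q 0) != 0 by rewrite gt_eqF ?sqrtr_gt0.
have dr := is_deriveM (is_derive_cst (Num.sqrt (sqhead z)) (0 : R) (1 : R))
  (is_deriveV (f := Num.sqrt \o q) s0 (is_derive1_comp (is_derive1_sqrt qp) dq)).
exists (fun t => Num.sqrt (sqhead z) * (Num.sqrt (q t))^-1); split.
- by rewrite q0 -sqrtrV ?sqmod_ge0// -sqrtrM ?sqhead_ge0.
- apply: (is_derive_ext dr) => //.
  rewrite /cst/= scaler0 addr0 q0 /rho sqrtrM ?sqhead_ge0// sqrtrV ?sqmod_ge0//.
  rewrite /GRing.scale/=.
  have -> : complex.Re (c / zlast z) = D / sqmod (zlast z).
    rewrite /D; case: (c) (zlast z) => a b [a' b'] /=; rewrite /sqmod/=; ring.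
  have bE := sqr_sqrtr (sqmod_ge0 (zlast z)); rewrite q0 in s0.
  move: s0 bE; set s := Num.sqrt (sqmod _) => s0 <-.
  by field.
- move=> t; rewrite /rho sqhead_lineR zlast_lineR sqmod_line -/D -/(q t).
  have qt : 0 <= q t by rewrite /q /D -sqmod_line sqmod_ge0.
  by rewrite ger0_norm ?divr_ge0 ?sqrtr_ge0// sqrtrM ?sqhead_ge0// sqrtrV.
Qed.

(** Factoring z_(n+1) + t c = z_(n+1) (1 + t d) with d = c / z_(n+1), the second factor has positive
    real part for small t, so its argument is given by [atan]. *)
Lemma arg_lineR z c : zlast z != 0 -> exists th : R -> R,
  [/\ th 0 = theta z, is_derive (0 : R) 1 th (complex.Im (c / zlast z))
    & \forall t \near (0 : R),
        is_arg (zlast (z + (t%:C * c) *: delta_mx 0 (rshift n ord0))) (th t)].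
Proof.
move=> z0; set d := c / zlast z.
pose x (t : R) := 1 + t * complex.Re d; pose y (t : R) := t * complex.Im d.
have idd : is_derive (0 : R) 1 (id : R -> R) 1 := is_derive_id (0 : R) (1 : R).
have dx : is_derive (0 : R) 1 x (complex.Re d).
  apply: (is_derive_ext (is_deriveD (is_derive_cst (1:R) (0 : R) (1 : R))
    (is_deriveM idd (is_derive_cst (complex.Re d) (0 : R) (1 : R))))) => //.
  by rewrite add0r /cst scaler0 add0r; exact: mulr1.
have dy : is_derive (0 : R) 1 y (complex.Im d).
  apply: (is_derive_ext 
    (is_deriveM idd (is_derive_cst (complex.Im d) (0 : R) (1 : R)))) => //.
  by rewrite /cst scaler0 add0r; exact: mulr1.
have x0 : x 0 = 1 by rewrite /x mul0r addr0.
have y0 : y 0 = 0 by rewrite /y mul0r.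
have x0' : x 0 != 0 by rewrite x0 oner_eq0.
have dq := is_deriveM dy (is_deriveV x0' dx).
have dth := is_deriveD (is_derive_cst (theta z) (0 : R) (1 : R))
  (is_derive1_comp (is_derive1_atan _) dq).
exists (fun t => theta z + atan (y t / x t)); split.
- by rewrite y0 mul0r atan0 addr0.
- apply: (is_derive_ext dth) => //.
  by rewrite !fctE x0 y0 /GRing.scale/=; field.
- have cx : {for 0, continuous x}.
    apply/differentiable_continuous/derivable1_diffP; exact: ex_derive.
  have x1 : 0 < x 0 by rewrite x0.
  apply: filterS (cvgr_gt _ cx _ x1) => t xt.
  rewrite zlast_lineR.
  have -> : zlast z + t%:C * c = zlast z * (x t +i* y t).
    have -> : x t +i* y t = 1 + t%:C * d.
      by rewrite /x /y; case: (d) => a b; simpc.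
    by rewrite /d; field.
  by apply: is_argM (theta_arg z0) (is_arg_atan _).
Qed.

Lemma ReZ (a : R) c : complex.Re (a%:C * c) = a * complex.Re c.
Proof. by case: c => x y /=; rewrite mul0r subr0. Qed.

Lemma twoC (a : R) : 2 * a%:C = (2 * a)%:C.
Proof. by rewrite rmorphM/= rmorph_nat. Qed.

(** The chain rule with d rho/dz_j = rho conj(z_j) / (2 |z'|^2), d rho/dz_(n+1) = - rho / (2
    z_(n+1)) and d theta/dz_(n+1) = - i / (2 z_(n+1)). *)
Definition dpolar h z : 'I_(n + 1) -> R[i] :=
  let hr := drho h (rho z) (theta z) in
  coef (fun j => (hr * rho z / (2 * sqhead z))%:C * (z 0 (lshift 1 j))^*%C)
       (((- (rho z * hr))%:C - 'i%C * (dtheta h (rho z) (theta z))%:C)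
        / (2 * zlast z)).

Lemma has_dz_polar h z : zlast z != 0 -> theta_smooth h ->
  cvg (drho_quot h (rho z) (theta z) @ rho_nbhs (rho z)) ->
  (rho z = 0 -> drho h (rho z) (theta z) = 0) ->
  has_dz (polar h) z (dpolar h z) (fun k => (dpolar h z k)^*%C).
Proof.
(* As [polar h] is real, its derivative in direction c has the form a c + conj(a c) = 2 Re (a c). *)
move=> z0 sh ch h0; apply: ord_last_ind => [j c|c]; rewrite -rmorphM/= addcJ.
  have [r [r' [r0 dr rt rE]]] := rho_lineL j c z0.
  have := is_derive_even_chain (r := r) (th := cst (theta z)) sh (s := 0).
  rewrite r0 /= => /(_ r' 0 (rho_ge0 z) ch h0 dr (is_derive_cst _ _ _)).
  move/is_cder_real => H; rewrite (_ : (fun t => polar h _) =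
    fun t => (h `|r t| (theta z))%:C); first apply: is_cder_eq H _.
  rewrite /dpolar coefL mulr0 addr0 -mulrA ReZ twoC -mulrA; congr (_%:C).
  have [r00|r00] := eqVneq (rho z) 0; first by rewrite h0// !(mul0r, mulr0).
  by rewrite rE//; field; rewrite -rho_eq0.
  apply/funext => t; rewrite /polar rt.
  by rewrite (theta_smooth_arg sh _ _ (t := theta z))// zlast_lineL//; exact: theta_arg.
have [r [r0 dr rt]] := rho_lineR c z0.
have [th [th0 dth tht]] := arg_lineR c z0.
have := is_derive_even_chain (r := r) (th := th) sh (s := 0).
rewrite r0 th0 => /(_ _ _ (rho_ge0 z) ch h0 dr dth).
move/is_cder_real/is_cder_near => H.
apply: is_cder_eq; first apply: H.
  have zt := has_dz_neq0 (has_dz_zlast z) z0 (rshift n ord0) c.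
  apply: filterS2 tht zt => t tht zt; rewrite /polar rt.
  by rewrite (theta_smooth_arg sh _ zt tht).
rewrite /dpolar coefR twoC.
set hr := drho h _ _; set ht := dtheta h _ _.
have -> : ((- (rho z * hr))%:C - 'i%C * ht%:C) / (2 * zlast z) * c =
    2^-1%:C * (((- (rho z * hr))%:C - 'i%C * ht%:C) * (c / zlast z)).
  by rewrite fmorphV rmorph_nat; field.
rewrite ReZ mulVKf ?pnatr_eq0//; congr (_%:C); case: (c / zlast z) => x y /=.
ring.
Qed.

End PolarFunctions.

Lemma conjcZ (R : realType) (a : R) (c : R[i]) : (a%:C * c)^*%C = a%:C * c^*%C.
Proof. by rewrite rmorphM; congr (_ * _); exact: conjc_real. Qed.

Section ComplexCoercions.
Context {R : realType}.
Implicit Types (a b : R) (c d : R[i]).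

Lemma realcD a b : (a + b)%:C = a%:C + b%:C. Proof. exact: rmorphD. Qed.
Lemma realcB a b : (a - b)%:C = a%:C - b%:C. Proof. exact: rmorphB. Qed.
Lemma realcN a : (- a)%:C = - a%:C. Proof. exact: rmorphN. Qed.
Lemma realcM a b : (a * b)%:C = a%:C * b%:C. Proof. exact: rmorphM. Qed.
Lemma realcV a : (a^-1)%:C = a%:C^-1. Proof. exact: fmorphV. Qed.
Lemma realcX a m : (a ^+ m)%:C = a%:C ^+ m. Proof. exact: rmorphXn. Qed.
Lemma realc_nat m : (m%:R : R)%:C = m%:R. Proof. exact: rmorph_nat. Qed.
Definition realcE := (realc_nat, realcD, realcB, realcN, realcM, realcV, realcX).

Lemma conjcD c d : (c + d)^*%C = c^*%C + d^*%C. Proof. exact: rmorphD. Qed.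
Lemma conjcB c d : (c - d)^*%C = c^*%C - d^*%C. Proof. exact: rmorphB. Qed.
Lemma conjcN c : (- c)^*%C = - c^*%C. Proof. exact: rmorphN. Qed.
Lemma conjcM c d : (c * d)^*%C = c^*%C * d^*%C. Proof. exact: rmorphM. Qed.
Lemma conjcV c : (c^-1)^*%C = c^*%C^-1. Proof. exact: fmorphV. Qed.
Lemma conjci : 'i%C^*%C = - 'i%C :> R[i]. Proof. by simpc. Qed.
Lemma conjc_natr m : (m%:R : R[i])^*%C = m%:R. Proof. exact: rmorph_nat. Qed.
Definition conjcE :=
  (conjcD, conjcB, conjcN, conjcM, conjcV, conjci, conjc_natr, conjc_real, @conjcK R).

End ComplexCoercions.

(** * The term conj(z_j) (1/rho) df/drho and its derivatives *)

Section RadialSlope.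
Context {R : realType} {n : nat}.
Implicit Types (z : 'rV[R[i]]_(n + 1)) (c : R[i]) (j : 'I_n).
Variable theta : 'rV[R[i]]_(n + 1) -> R.
Hypothesis theta_arg : forall z, zlast z != 0 -> is_arg (zlast z) (theta z).
Variables (f : R -> R -> R) (hf : in_D f).

Local Notation pol := (polar theta).

Definition slope j z : R[i] :=
  (z 0 (lshift 1 j))^*%C * (pol (drho f) z * pol rho_inv z).

Definition frr z : R := drho (drho f) (rho z) (theta z).
Definition fr_over z : R := drho_over_rho f (rho z) (theta z).

Lemma slopeE j z : zlast z != 0 ->
  slope j z = (z 0 (lshift 1 j))^*%C * (fr_over z)%:C.
Proof.
move=> z0; rewrite /slope /fr_over /drho_over_rho /polar /rho_inv.
have [/eqP r0|r0] := ifPn; last by congr (_ * _); rewrite mulrC -rmorphM.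
have a0 : sqhead z = 0 by apply/eqP; rewrite -rho_eq0// r0.
by rewrite (sqhead_eq0 j a0) conjc0 !mul0r.
Qed.

(** Arises from rho d/drho (f_rho / rho) = f_rho_rho - f_rho / rho together with d rho/dz_i = rho
    conj(z_i) / (2 |z'|^2): the z_i-derivative of f_rho / rho is [dslope z] times conj(z_i), and
    [dslope_last] is its derivative in z_(n+1). *)
Definition dslope z : R[i] := ((frr z - fr_over z) / (2 * sqhead z))%:C.

Definition dslope_last z : R[i] :=
  ((- (frr z - fr_over z))%:C
   - 'i%C * ((rho z)^-1 * dtheta (drho f) (rho z) (theta z))%:C) / (2 * zlast z).

(** The difference quotient at 0 is drho f / rho at rho = |x| K. As drho f vanishes at rho = 0, this
    is the one-sided quotient of drho f itself. *)
Lemma is_derive_abs_quot (K t : R) : 0 < K ->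
  is_derive (0 : R) 1 (fun x => x * (drho f (`|x| * K) t / (`|x| * K)))
    (drho (drho f) 0 t).
Proof.
move=> K0; apply/is_derive_quotP.
have cK : (fun x : R => `|x| * K) @ 0^' --> rho_nbhs (0 : R).
  suff : (fun x : R => `|x| * K) @ 0^' `=>` 0^'+.
    move=> H; exact: (cvg_trans H (at_right_rho_nbhs (lexx 0))).
  move=> P [e /= e0 He]; exists (e / K) => /=; first exact: divr_gt0.
  move=> x /= xe x0; apply: He => /=; last by rewrite mulr_gt0// normr_gt0.
  move: xe; rewrite !sub0r !normrN ltr_pdivlMr// => xe.
  by rewrite ger0_norm// mulr_ge0// ltW.
have H := cvg_comp _ _ cK (@in_D_cvg_drho _ f hf 0 t (lexx 0)).
apply: cvg_trans H; apply: near_eq_cvg; near=> x.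
have x0 : x != 0 by near: x; exact: nbhs_dnbhs_neq.
rewrite /= /drho_quot !add0r (in_D_drho0 hf) !subr0 mul0r subr0 mulKf//.
by rewrite mulrC.
Unshelve. all: by end_near. Qed.

Lemma has_dz_slope j z : zlast z != 0 ->
  has_dz (slope j) z
    (coef (fun k => (z 0 (lshift 1 j))^*%C * dslope z * (z 0 (lshift 1 k))^*%C)
          ((z 0 (lshift 1 j))^*%C * dslope_last z))
    (coef (fun k => (k == j)%:R * (fr_over z)%:C
                    + (z 0 (lshift 1 j))^*%C * dslope z * z 0 (lshift 1 k))
          ((z 0 (lshift 1 j))^*%C * (dslope_last z)^*%C)).
Proof.
move=> z0; have [a0|a0] := eqVneq (sqhead z) 0.
  have r0 : rho z = 0 by apply/eqP; rewrite rho_eq0// a0.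
  have zj0 := sqhead_eq0 _ a0.
  (* At z' = 0 the factor conj(z_j) stays 0 along every coordinate line other than the j-th, so
     [slope] is constant there. *)
  apply: ord_last_ind => [i c|c]; last first.
    rewrite !coefR zj0 conjc0 !mul0r addr0.
    rewrite (_ : (fun t => _) = cst 0); first exact: is_cder_cst.
    by apply/funext => t; rewrite /slope head_line ?eq_rlshift// zj0 conjc0 mul0r.
  rewrite !coefL !zj0 conjc0 !mul0r add0r addr0.
  have [->{i}|ij] := eqVneq i j; last first.
    rewrite !mul0r.
    rewrite (_ : (fun t => _) = cst 0); first exact: is_cder_cst.
    by apply/funext => t; rewrite /slope head_line ?eq_lshift// zj0 conjc0 mul0r.
  rewrite mul1r.
  have [->|c0] := eqVneq c 0.
    rewrite conjc0 mulr0.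
    rewrite (_ : (fun t => _) = cst 0); first exact: is_cder_cst.
    by apply/funext => t; rewrite mulr0 scale0r addr0 /slope zj0 conjc0 mul0r.
  have K0 : 0 < Num.sqrt (sqmod c / sqmod (zlast z)).
    by rewrite sqrtr_gt0 divr_gt0// sqmod_gt0.
  (* Along the j-th line conj(z_j) = t conj(c) and rho = |t| K with K = |c| / |z_(n+1)|. The real
     factor t joins the quotient, leaving conj(c) in front; hence only the zbar_j-derivative is
     nonzero. *)
  have H := is_cderM (is_cder_cst c^*%C)
    (is_cder_real (is_derive_abs_quot (theta z) K0)).
  rewrite (_ : (fun t => slope j _) = (fun t => cst c^*%C t *
      (t * (drho f (`|t| * Num.sqrt (sqmod c / sqmod (zlast z))) (theta z) /
        (`|t| * Num.sqrt (sqmod c / sqmod (zlast z)))))%:C)).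
    apply: is_cder_eq H _.
    rewrite mul0r add0r mulrC /fr_over /drho_over_rho r0 eqxx.
    by [].
  apply/funext => t; rewrite /slope /polar /rho_inv.
  have -> : (z + (t%:C * c) *: delta_mx 0 (lshift 1 j)) 0 (lshift 1 j) = t%:C * c.
    by rewrite !mxE !eqxx zj0 mulr1 add0r.
  rewrite conjcZ rho_line_sqhead0//.
  rewrite (theta_smooth_arg theta_arg (t := theta z) (in_D_theta_smooth_drho hf)).
  - by rewrite !rmorphM/= /cst; ring.
  - by rewrite mulr_ge0// ltW.
  - by rewrite zlast_lineL.
  - by rewrite zlast_lineL; exact: theta_arg.
have r0 : rho z != 0 by rewrite rho_eq0.
have rp : 0 < rho z by rewrite lt0r r0 rho_ge0.
have hr : has_dz (pol (drho f)) z (dpolar theta (drho f) z)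
    (fun k => (dpolar theta (drho f) z k)^*%C).
  apply: has_dz_polar => //.
  - exact: in_D_theta_smooth_drho.
  - by apply: in_D_cvg_drho => //; exact: rho_ge0.
  - by move=> r00; rewrite r00 eqxx in r0.
have hi : has_dz (pol rho_inv) z (dpolar theta rho_inv z)
    (fun k => (dpolar theta rho_inv z k)^*%C).
  apply: has_dz_polar => //.
  - exact: theta_smooth_rho_inv.
  - by apply/cvg_ex; exists (- rho z ^- 2); exact: drho_quot_rho_inv.
  - by move=> r00; rewrite r00 eqxx in r0.
have pE : fr_over z = (rho z)^-1 * drho f (rho z) (theta z).
  by rewrite /fr_over /drho_over_rho (negPf r0).
have iE : drho rho_inv (rho z) (theta z) = - rho z ^- 2.
  by apply: drho_eq; [exact: rho_ge0|exact: drho_quot_rho_inv].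
have cr0 : (rho z)%:C != 0 by rewrite fmorph_eq0.
have ca0 : (sqhead z)%:C != 0 by rewrite fmorph_eq0.
(* The z_k-derivative of f_rho / rho away from z' = 0. *)
pose X k := dpolar theta (drho f) z k * pol rho_inv z
            + pol (drho f) z * dpolar theta rho_inv z k.
have XL i : X (lshift 1 i) = dslope z * (z 0 (lshift 1 i))^*%C.
  rewrite /X /dpolar !coefL iE /polar /dslope pE /rho_inv !realcE.
  by field; rewrite ca0 cr0.
have XR : X (rshift n ord0) = dslope_last z.
  rewrite /X /dpolar !coefR iE dtheta_rho_inv /polar /dslope_last pE /rho_inv !realcE.
  by field; rewrite z0 cr0.
have XC k : (dpolar theta (drho f) z k)^*%C * pol rho_inv z
    + pol (drho f) z * (dpolar theta rho_inv z k)^*%C = (X k)^*%C.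
  by rewrite /X /polar !conjcE.
apply: has_dz_eq (has_dzM (has_dz_conj (has_dz_coord (lshift 1 j) z)) (has_dzM hr hi)) _ _.
  apply: ord_last_ind => [i|]; rewrite ?coefL ?coefR conjc0 mul0r add0r
    -?mulrA; congr (_ * _).
    exact: XL.
  exact: XR.
move=> k; rewrite /= XC; move: k; apply: ord_last_ind => [i|];
  rewrite ?coefL ?coefR ?XL ?XR conjc_natr.
  rewrite eq_lshift -!mulrA; congr (_ * _ + _ * _).
    by rewrite /polar pE mulrC realcM.
  by rewrite /dslope !conjcE.
by rewrite eq_rlshift mul0r add0r.
Qed.

End RadialSlope.

(** * The fields T_k and Tbar_k in terms of coefficient vectors *)

Section TangentialFields.
Context {R : realType} {n : nat}.
Implicit Types (z : 'rV[R[i]]_(n + 1)) (c : R[i]) (j : 'I_n).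

Lemma has_dzZ (F : 'rV[R[i]]_(n + 1) -> R[i]) z a b c : has_dz F z a b ->
  has_dz (fun z => c * F z) z (fun k => c * a k) (fun k => c * b k).
Proof.
move=> H; apply: has_dz_eq (has_dzM (has_dz_cst c z) H) _ _ => k;
  by rewrite /cst mul0r add0r.
Qed.

Definition tangent z (a : 'I_(n + 1) -> R[i]) k : R[i] :=
  a k - (z 0 k)^*%C * \sum_i z 0 i * a i.

Definition tangentbar z (b : 'I_(n + 1) -> R[i]) k : R[i] :=
  b k - z 0 k * \sum_i (z 0 i)^*%C * b i.

Lemma tangent_conj z b k :
  tangent z (fun i => (b i)^*%C) k = (tangentbar z b k)^*%C.
Proof.
rewrite /tangentbar conjcB conjcM rmorph_sum; congr (_ - _ * _).
by apply: eq_bigr => i _; rewrite [RHS]rmorphM/= conjcK.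
Qed.

Lemma TfieldE F z a b k : has_dz F z a b -> Tfield k F z = tangent z a k.
Proof.
move=> H; rewrite /Tfield /euler (has_dzE _ H); congr (_ - _ * _).
by apply: eq_bigr => i _; rewrite (has_dzE _ H).
Qed.

Lemma TbarfieldE F z a b k : has_dz F z a b -> Tbarfield k F z = tangentbar z b k.
Proof.
move=> H; rewrite /Tbarfield /eulerbar (has_dzbarE _ H); congr (_ - _ * _).
by apply: eq_bigr => i _; rewrite (has_dzbarE _ H).
Qed.

Lemma tangentbar_conj z a k :
  tangentbar z (fun i => (a i)^*%C) k = (tangent z a k)^*%C.
Proof.
rewrite /tangent conjcB conjcM rmorph_sum conjcK; congr (_ - _ * _).
by apply: eq_bigr => i _; rewrite [RHS]rmorphM.
Qed.

(* For a real function [G] the two mixed second order terms are conjugate to each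
   other, so only one of them has to be computed. *)
Lemma second_order_real (E G : 'rV[R[i]]_(n + 1) -> R[i]) a (b : 'I_(n + 1) -> _)
    (U : 'I_(n + 1) -> 'rV[R[i]]_(n + 1) -> R[i]) :
  (forall z, zlast z != 0 -> G z = E z) ->
  (forall z, zlast z != 0 -> has_dz G z (a z) (fun k => (a z k)^*%C)) ->
  (forall k z, zlast z != 0 -> tangent z (a z) k = U k z) ->
  (forall k z, zlast z != 0 -> exists a', has_dz (U k) z a' (b k z)) ->
  forall z, zlast z != 0 ->
  [/\ pderivable E z, forall k, pderivable (Tfield k E) z,
      forall k, pderivable (Tbarfield k E) z
    & forall k, Tfield k (Tbarfield k E) z + Tbarfield k (Tfield k E) z =
        2 * (complex.Re (tangentbar z (b k z) k))%:C].
Proof.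
move=> GE HG GU HU z z0.
have HE w : zlast w != 0 -> has_dz E w (a w) (fun k => (a w k)^*%C).
  by move=> w0; exact: has_dz_cone w0 GE (HG w w0).
have UE k w : zlast w != 0 -> U k w = Tfield k E w.
  by move=> w0; rewrite (TfieldE _ (HE w w0)) GU.
have UbE k w : zlast w != 0 -> (U k w)^*%C = Tbarfield k E w.
  by move=> w0; rewrite (TbarfieldE _ (HE w w0)) tangentbar_conj GU.
have dU k : exists a', has_dz (Tfield k E) z a' (b k z).
  by have [a' H] := HU k z z0; exists a'; exact: has_dz_cone z0 (UE k) H.
have dUb k : exists b', has_dz (Tbarfield k E) z (fun i => (b k z i)^*%C) b'.
  have [a' H] := HU k z z0; exists (fun i => (a' i)^*%C).
  exact: has_dz_cone z0 (UbE k) (has_dz_conj H).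
split.
- exact: has_dz_pderivable (HE z z0).
- by move=> k; have [a' H] := dU k; exact: has_dz_pderivable H.
- by move=> k; have [b' H] := dUb k; exact: has_dz_pderivable H.
- move=> k; have [a' H] := dU k; have [b' Hb] := dUb k.
  by rewrite (TfieldE _ Hb) (TbarfieldE _ H) tangent_conj addrC addcJ.
Qed.

End TangentialFields.

(** * The Euler field on functions of (rho, theta) *)

Section Computation.
Context {R : realType} {n : nat}.
Implicit Types (z : 'rV[R[i]]_(n + 1)) (c : R[i]) (j : 'I_n) (h : R -> R -> R).
Variable theta : 'rV[R[i]]_(n + 1) -> R.

Lemma sqheadE z :
  (sqhead z)%:C = \sum_(j < n) z 0 (lshift 1 j) * (z 0 (lshift 1 j))^*%C.
Proof. by rewrite rmorph_sum; apply: eq_bigr => j _; exact: sqmodE. Qed.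

Lemma rho_sqhead0 z : sqhead z = 0 -> rho z = 0.
Proof. by rewrite /rho => ->; rewrite mul0r sqrtr0. Qed.

(** Multiplying z by a complex scalar leaves rho fixed and only shifts theta, so the rho-terms of
    the head and of the last coordinate cancel. *)
Lemma euler_dpolar h z : zlast z != 0 ->
  \sum_k z 0 k * dpolar theta h z k =
  - ('i%C / 2) * (dtheta h (rho z) (theta z))%:C.
Proof.
move=> z0; rewrite sum_last /dpolar coefR.
set hr := drho h _ _; set A := hr * rho z / (2 * sqhead z).
rewrite (eq_bigr (fun j => A%:C * (z 0 (lshift 1 j) * (z 0 (lshift 1 j))^*%C))).
  rewrite -mulr_sumr -sqheadE -realcM.
  have -> : A * sqhead z = hr * rho z / 2.
    have [a0|a0] := eqVneq (sqhead z) 0; last by rewrite /A; field.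
    by rewrite (rho_sqhead0 a0) a0 !mulr0 mul0r.
  rewrite -/(zlast z) !realcE. by field.
by move=> j _; rewrite coefL mulrCA.
Qed.

Lemma eulerbar_dpolar h z : zlast z != 0 ->
  \sum_k (z 0 k)^*%C * (dpolar theta h z k)^*%C =
  ('i%C / 2) * (dtheta h (rho z) (theta z))%:C.
Proof.
move=> z0; transitivity ((\sum_k z 0 k * dpolar theta h z k)^*%C).
  by rewrite rmorph_sum; apply: eq_bigr => k _; rewrite [RHS]rmorphM.
by rewrite euler_dpolar// !conjcE; field.
Qed.

End Computation.

(** * Closed forms of T_k G and of Tbar_k T_k G *)

Section HeadAndLast.
Context {R : realType} {n : nat}.
Implicit Types (z : 'rV[R[i]]_(n + 1)) (c : R[i]) (j : 'I_n).
Variable theta : 'rV[R[i]]_(n + 1) -> R.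
Hypothesis theta_arg : forall z, zlast z != 0 -> is_arg (zlast z) (theta z).
Variables (f : R -> R -> R) (hf : in_D f).

Local Notation pol := (polar theta).
Local Notation dpol := (dpolar theta).
Local Notation q := (dtheta f).
Local Notation s := (rho_mul (drho f)).
Local Notation last := (rshift n ord0).

Lemma has_dz_polar_f z : zlast z != 0 ->
  has_dz (pol f) z (dpol f z) (fun k => (dpol f z k)^*%C).
Proof.
move=> z0; apply: has_dz_polar => //.
- exact: in_D_theta_smooth.
- by apply: in_D_cvg => //; exact: rho_ge0.
- by move=> ->; exact: in_D_drho0.
Qed.

Lemma has_dz_polar_dtheta z : zlast z != 0 ->
  has_dz (pol q) z (dpol q z) (fun k => (dpol q z k)^*%C).
Proof.
move=> z0; apply: has_dz_polar => //.
- exact: in_D_theta_smooth_dtheta.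
- by apply: in_D_cvg_dtheta => //; exact: rho_ge0.
- by move=> ->; exact: in_D_drho_dtheta0.
Qed.

Lemma drho_rho_mul_drho z :
  drho s (rho z) (theta z) = drho f (rho z) (theta z) + rho z * frr theta f z.
Proof.
apply: drho_eq; first exact: rho_ge0.
by apply: drho_quot_rho_mul; [exact: rho_ge0|apply: in_D_cvg_drho => //; exact: rho_ge0].
Qed.

Lemma has_dz_polar_rho_mul z : zlast z != 0 ->
  has_dz (pol s) z (dpol s z) (fun k => (dpol s z k)^*%C).
Proof.
move=> z0; apply: has_dz_polar => //.
- exact/theta_smooth_rho_mul/in_D_theta_smooth_drho.
- apply/cvg_ex; eexists; apply: drho_quot_rho_mul; first exact: rho_ge0.
  by apply: in_D_cvg_drho => //; exact: rho_ge0.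
- by move=> r0; rewrite drho_rho_mul_drho r0 mul0r addr0 in_D_drho0.
Qed.

Definition Thead j z : R[i] :=
  slope theta f j z * (2 * (zlast z * (zlast z)^*%C))^-1
  + 'i%C / 2 * ((z 0 (lshift 1 j))^*%C * pol q z).

(** Here df/drho enters through rho df/drho, whose rho-derivative vanishes at the boundary, so
    [has_dz_polar] applies directly; [Thead] needs [slope] instead. *)
Definition Tlast z : R[i] :=
  (pol s z + 'i%C * pol q z) * (- 2 * zlast z)^-1
  + 'i%C / 2 * ((zlast z)^*%C * pol q z).

Lemma tangent_dpolar k z : zlast z != 0 ->
  tangent z (dpol f z) k = coef Thead Tlast k z.
Proof.
move=> z0; have zb0 : (zlast z)^*%C != 0 by rewrite conjc_eq0.
rewrite /tangent euler_dpolar//; move: k; apply: ord_last_ind => [j|].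
  rewrite /dpolar !coefL /Thead slopeE//.
  have [a0|a0] := eqVneq (sqhead z) 0.
    by rewrite (sqhead_eq0 j a0) conjc0 !(mul0r, mulr0) subr0 addr0.
  have r0 : rho z != 0 by rewrite rho_eq0.
  have cr0 : (rho z)%:C != 0 by rewrite fmorph_eq0.
  have -> : sqhead z = rho z ^+ 2 * sqmod (zlast z).
    by rewrite sqr_rho divfK// sqmod_eq0.
  rewrite /fr_over /drho_over_rho (negPf r0) /polar.
  move: (sqmod _) (sqmodE (zlast z)) => b bE; rewrite !realcE bE.
  by field; rewrite z0 zb0 cr0.
rewrite /dpolar !coefR /Tlast /polar /rho_mul -/(zlast z) !realcE.
by field; rewrite z0.
Qed.

(** The product rule applied to [Thead j], conjugate derivatives only; A z_i is the
    zbar_i-derivative of [pol q], and - B / conj(z_(n+1)) is the zbar_(n+1)-derivative of B. *)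
Definition dbar_head j z : 'I_(n + 1) -> R[i] :=
  let zj := (z 0 (lshift 1 j))^*%C in
  let B := (2 * (zlast z * (zlast z)^*%C))^-1 in
  let A := (drho q (rho z) (theta z) * rho z / (2 * sqhead z))%:C in
  coef (fun i => ((i == j)%:R * (fr_over theta f z)%:C
                  + zj * dslope theta f z * z 0 (lshift 1 i)) * B
          + 'i%C / 2 * ((i == j)%:R * pol q z + zj * A * z 0 (lshift 1 i)))
       (zj * (dslope_last theta f z)^*%C * B
        - zj * (fr_over theta f z)%:C * (B / (zlast z)^*%C)
        + 'i%C / 2 * (zj * (dpol q z last)^*%C)).

Lemma has_dz_Thead j z : zlast z != 0 ->
  exists a, has_dz (Thead j) z a (dbar_head j z).
Proof.
move=> z0; have zb0 : (zlast z)^*%C != 0 by rewrite conjc_eq0.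
have hl := has_dz_zlast z.
have n0 : 2 * (zlast z * (zlast z)^*%C) != 0 :> R[i].
  by rewrite !mulf_neq0// pnatr_eq0.
eexists.
apply: has_dz_eq (has_dzD
  (has_dzM (has_dz_slope theta_arg hf j z0)
           (has_dzV n0 (has_dzZ 2 (has_dzM hl (has_dz_conj hl)))))
  (has_dzZ ('i%C / 2) (has_dzM (has_dz_conj (has_dz_coord (lshift 1 j) z))
                               (has_dz_polar_dtheta z0)))) (fun=> erefl) _.
rewrite /dbar_head; apply: ord_last_ind => [i|];
  rewrite ?coefL ?coefR /cst slopeE// conjc_natr.
  rewrite eq_lshift conjc0 /dpolar coefL !conjcE.
  rewrite mul0r mulr0 addr0 mulr0 oppr0 mul0r mulr0 addr0.
  by congr (_ + _ * (_ + _)); rewrite mulrA.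
have E (a b : R[i]) : a != 0 -> b != 0 ->
    - (2 * a) / (2 * (a * b)) ^+ 2 = - ((2 * (a * b))^-1 / b).
  by move=> a0 b0; field; rewrite a0 b0.
by rewrite eq_rlshift conjc1 !mul0r !add0r mulr1 E// mulrN.
Qed.

Definition dbar_last z k : R[i] :=
  ((dpol s z k)^*%C + 'i%C * (dpol q z k)^*%C) * (- 2 * zlast z)^-1
  + 'i%C / 2 * ((k == last)%:R * pol q z + (zlast z)^*%C * (dpol q z k)^*%C).

Lemma has_dz_Tlast z : zlast z != 0 ->
  exists a, has_dz Tlast z a (dbar_last z).
Proof.
move=> z0.
have hl := has_dz_zlast z.
have n0 : - 2 * zlast z != 0 :> R[i].
  by rewrite mulf_neq0// oppr_eq0 pnatr_eq0.
have hq := has_dz_polar_dtheta z0.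
eexists.
apply: has_dz_eq (has_dzD
  (has_dzM (has_dzD (has_dz_polar_rho_mul z0) (has_dzZ 'i%C hq))
           (has_dzV n0 (has_dzZ (- 2) hl)))
  (has_dzZ ('i%C / 2) (has_dzM (has_dz_conj hl) hq))) (fun=> erefl) _.
rewrite /dbar_last; apply: ord_last_ind => [i|]; rewrite ?coefL ?coefR /cst.
  by rewrite eq_lrshift conjc0 mulr0 oppr0 mul0r mulr0 addr0.
by rewrite eqxx conjc1 mulr0 oppr0 mul0r mulr0 addr0.
Qed.

Lemma sum_head_delta z j (x y : R[i]) :
  \sum_(i < n) (z 0 (lshift 1 i))^*%C * ((i == j)%:R * x + y * z 0 (lshift 1 i)) =
  (z 0 (lshift 1 j))^*%C * x + y * (sqhead z)%:C.
Proof.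
rewrite (eq_bigr (fun i => (z 0 (lshift 1 i))^*%C * ((i == j)%:R * x)
    + y * (z 0 (lshift 1 i) * (z 0 (lshift 1 i))^*%C))); last first.
  by move=> i _; ring.
rewrite big_split/= -mulr_sumr -sqheadE (bigD1 j)//= eqxx mul1r big1 ?addr0//.
by move=> i ij; rewrite (negPf ij) mul0r mulr0.
Qed.

Lemma Re_tangentbar_head j z : zlast z != 0 ->
  complex.Re (tangentbar z (dbar_head j z) (lshift 1 j)) =
  (fr_over theta f z
   + sqmod (z 0 (lshift 1 j)) * ((frr theta f z - fr_over theta f z) / (2 * sqhead z)))
    / (2 * sqmod (zlast z))
  + sqmod (z 0 (lshift 1 j)) * dtheta q (rho z) (theta z) / 4.
Proof.
move=> z0; have zb0 : (zlast z)^*%C != 0 by rewrite conjc_eq0.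
set X := (RHS).
set N := sqmod (z 0 (lshift 1 j)).
set qz := q (rho z) (theta z).
pose A := drho q (rho z) (theta z) * rho z / (2 * sqhead z).
pose g := (rho z)^-1 * dtheta (drho f) (rho z) (theta z).
(* The imaginary part is written out so that the claim becomes one identity between complex numbers,
   open to [field]. *)
pose Y := (qz + N * A) / 2 - N * qz / 2 - N * g / (4 * sqmod (zlast z)).
suff -> : tangentbar z (dbar_head j z) (lshift 1 j) = X%:C + 'i%C * Y%:C.
  by rewrite /= !(mul0r, mul1r, mulr0) subr0 addr0.
rewrite /tangentbar sum_last /dbar_head !coefL !coefR eqxx !mul1r.
rewrite (eq_bigr (fun i =>
  ((z 0 (lshift 1 i))^*%C * ((i == j)%:R * (fr_over theta f z)%:C
                  + (z 0 (lshift 1 j))^*%C * dslope theta f z * z 0 (lshift 1 i)))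
     * (2 * (zlast z * (zlast z)^*%C))^-1
  + 'i%C / 2 * ((z 0 (lshift 1 i))^*%C * ((i == j)%:R * pol q z
         + (z 0 (lshift 1 j))^*%C * A%:C * z 0 (lshift 1 i))))); last first.
  by move=> i _; rewrite coefL -/A; ring.
rewrite big_split/= -mulr_suml -mulr_sumr !sum_head_delta -/(zlast z).
rewrite {}/X {}/Y -/A /dslope /dslope_last /dpolar coefR /polar -/qz.
have zja : sqhead z = 0 -> z 0 (lshift 1 j) = 0 /\ (z 0 (lshift 1 j))^*%C = 0.
  by move=> /sqhead_eq0 ->; rewrite conjc0.
move: (sqmodE (z 0 (lshift 1 j))) (sqmodE (zlast z)) zja.
rewrite {}/N {}/A {}/g {}/qz.
move: (sqmod (zlast z)) (sqmod (z 0 (lshift 1 j))) => b N.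
move: (drho q _ _) (dtheta q _ _) (dtheta (drho f) _ _) (q (rho z) _) => qr qt ft q0.
move: (fr_over _ _ _) (frr _ _ _) (rho z) (sqhead z) => p p' r a NE bE.
(* [field] does not know that i^2 = -1; the product of two i's coming from the last coordinate is
   reduced by hand. *)
have iE (w x y c : R[i]) : c != 0 ->
    'i%C / 2 * (w * ((- x - - 'i%C * y) / c)) = - w * ('i%C * x + y) / (2 * c).
  by move=> c0; rewrite -[y in RHS]opprK -[- y]mulN1r -sqr_i; field.
rewrite !(conjcE, realcE) NE bE iE ?mulf_neq0 ?pnatr_eq0// {NE bE}.
have [-> []// -> ->|a0 _] := eqVneq a 0.
  rewrite !(mul0r, mulr0, subr0, addr0, oppr0).
  move: z0 zb0; move: (zlast z) (zlast z)^*%C => zl zb z0 zb0.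
  move: (p%:C) (q0%:C) => {}p {}q0.
  by field; rewrite z0 zb0.
have ca0 : a%:C != 0 by rewrite fmorph_eq0.
move: z0 zb0 ca0 {a0}; move: (zlast z) (zlast z)^*%C => zl zb z0 zb0.
move: (z 0 (lshift 1 j)) (z 0 (lshift 1 j))^*%C => w wb.
(* The inverse of rho becomes a variable of its own, so [field] asks for no condition on rho. *)
move: (p%:C) (q0%:C) (p'%:C) (r%:C) (r%:C^-1) (a%:C) (qr%:C) (qt%:C) (ft%:C).
move=> {}p {}q0 {}p' {}r ri {}a {}qr {}qt {}ft ca0.
by field; rewrite z0 zb0 ca0.
Qed.

Lemma Re_tangentbar_last z : zlast z != 0 ->
  complex.Re (tangentbar z (dbar_last z) last) =
  (rho z * drho s (rho z) (theta z)
   + (1 - sqmod (zlast z)) * dtheta q (rho z) (theta z)) / (4 * sqmod (zlast z))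
  - (1 - sqmod (zlast z)) * dtheta q (rho z) (theta z) / 4.
Proof.
move=> z0; have zb0 : (zlast z)^*%C != 0 by rewrite conjc_eq0.
set X := (RHS).
pose b := sqmod (zlast z).
pose qr := rho z * drho q (rho z) (theta z).
pose st := dtheta s (rho z) (theta z).
pose q0 := q (rho z) (theta z).
pose Y := (qr - st) / (4 * b) + q0 / 2 - qr / 4 + st / 4 - b * q0 / 2.
suff -> : tangentbar z (dbar_last z) last = X%:C + 'i%C * Y%:C.
  by rewrite /= !(mul0r, mul1r, mulr0) subr0 addr0.
(* The conjugate Euler field applied to [Tlast]: each polar factor contributes through
   [eulerbar_dpolar], and differentiating conj(z_(n+1)) reproduces it. *)
have sumE : \sum_k (z 0 k)^*%C * dbar_last z k =
    ('i%C / 2 * st%:C + 'i%C * ('i%C / 2 * (dtheta q (rho z) (theta z))%:C))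
      * (- 2 * zlast z)^-1
    + 'i%C / 2 * ((zlast z)^*%C * q0%:C
                  + (zlast z)^*%C * ('i%C / 2 * (dtheta q (rho z) (theta z))%:C)).
  rewrite -!(eulerbar_dpolar theta _ z0) !mulr_sumr -big_split/= mulr_suml.
  have -> : (zlast z)^*%C * q0%:C = \sum_k (z 0 k)^*%C * ((k == last)%:R * q0%:C).
    rewrite (bigD1 last)//= eqxx mul1r big1 ?addr0// => k kl.
    by rewrite (negPf kl) mul0r mulr0.
  rewrite -big_split/= mulr_sumr -big_split/=; apply: eq_bigr => k _.
  rewrite /dbar_last /polar -/q0.
  move: (dpol s z k)^*%C (dpol q z k)^*%C (zlast z)^*%C (- 2 * zlast z)^-1 => u v w x.
  by move: (z 0 k)^*%C (k == last)%:R (q0%:C) => y e c; ring.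
rewrite /tangentbar sumE /dbar_last eqxx mul1r /dpolar !coefR /polar -/(zlast z).
rewrite {}/X {}/Y {}/qr -/b; have := sqmodE (zlast z).
rewrite -/b -/st -/q0 {sumE}; move: b st q0 => b st q0.
move: (rho z) (dtheta q (rho z) (theta z)) (drho q (rho z) (theta z))
  (drho s (rho z) (theta z)) => r qt qr sr bE.
rewrite !(conjcE, realcE) bE rmorph1.
move: z0 zb0 {bE}; move: (zlast z) (zlast z)^*%C => zl zb z0 zb0.
move: (q0%:C) (st%:C) (qr%:C) (sr%:C) (r%:C) (qt%:C) => {}q0 {}st {}qr {}sr {}r {}qt.
(* With 1 written as - i^2 on the right, both sides agree with i as a formal variable. *)
rewrite [qt in RHS](_ : qt = - ('i%C ^+ 2 * qt)); last by rewrite sqr_i mulN1r opprK.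
by field; rewrite z0 zb0.
Qed.

End HeadAndLast.

(** * The chart and the values of [psi] on normalised points *)

Section Chart.
Context {R : realType} {n : nat}.
Implicit Types (z : 'rV[R[i]]_(n + 1)) (t : R) (c : R[i]).

Lemma sqmodV c : sqmod c^-1 = (sqmod c)^-1.
Proof.
have [->|c0] := eqVneq c 0; first by rewrite invr0 /sqmod/= !expr0n/= addr0 invr0.
apply: (mulfI (x := sqmod c)); first by rewrite sqmod_eq0.
by rewrite -sqmodM !divff ?sqmod_eq0// /sqmod/= expr1n expr0n/= addr0.
Qed.

Lemma hnormE z : hnorm z = Num.sqrt (sqhead z + sqmod (zlast z)).
Proof. by rewrite /hnorm big_split_ord/= big_ord1. Qed.

Definition affine_coord z : 'rV[R[i]]_n := \row_j (z 0 (lshift 1 j) / zlast z).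

Lemma hnorm_affine_coord z : hnorm (affine_coord z) = rho z.
Proof.
rewrite /hnorm /rho /sqhead mulr_suml; congr Num.sqrt.
by apply: eq_bigr => j _; rewrite mxE -sqmodV -sqmodM.
Qed.

(** The chart parameter w of z / |z| is z' / z_(n+1), which is unchanged by scaling and has norm
    [rho z]. *)
Lemma chart_point_affine_coord z t : zlast z != 0 -> is_arg (zlast z) t ->
  chart_point (affine_coord z) t = (hnorm z)^-1%:C *: z.
Proof.
move=> z0 zt; have b0 : 0 < sqmod (zlast z) by rewrite sqmod_gt0.
have m0 : 0 < Num.sqrt (sqmod (zlast z)) by rewrite sqrtr_gt0.
have h0 : 0 < hnorm z by rewrite hnormE sqrtr_gt0 ltr_wpDl ?sqhead_ge0.
rewrite /chart_point hnorm_affine_coord sqr_rho.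
have -> : 1 + sqhead z / sqmod (zlast z) = (sqhead z + sqmod (zlast z)) / sqmod (zlast z).
  by rewrite mulrDl divff ?gt_eqF// addrC.
have s0 := addr_ge0 (sqhead_ge0 z) (sqmod_ge0 (zlast z)).
rewrite (sqrtrM _ s0) sqrtrV ?sqmod_ge0// -hnormE.
have -> : expi t / (hnorm z / Num.sqrt (sqmod (zlast z)))%:C =
    zlast z * (hnorm z)^-1%:C.
  rewrite {2}zt !realcE invfM invrK; ring.
apply/rowP => k; rewrite !mxE; move: k; apply: ord_last_ind => [j|].
  by rewrite (unsplitK (inl j)) !mxE mulrC mulrA divfK// mulrC.
by rewrite (unsplitK (inr ord0)) !mxE mulr1 mulrC.
Qed.

Lemma is_arg_shift c t (k : int) : is_arg c t -> is_arg c (t + k%:~R * (2 * pi)).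
Proof.
rewrite /is_arg /expi !periodic_int// => s; first by rewrite mulr_natl sinD2pi.
by rewrite mulr_natl cosD2pi.
Qed.

Lemma psi_polar (psi : 'rV[R[i]]_(n + 1) -> R * R) z : is_psi psi -> zlast z != 0 ->
  (psi ((hnorm z)^-1%:C *: z)).1 = rho z /\
  is_arg (zlast z) (psi ((hnorm z)^-1%:C *: z)).2.
Proof.
move=> hpsi z0; have [t zt] := is_arg_exists (zlast z).
rewrite -(chart_point_affine_coord z0 zt).
have [-> [k ->]] := hpsi (affine_coord z) t.
by split; [exact: hnorm_affine_coord|exact: is_arg_shift].
Qed.

End Chart.

(** * Summation over the coordinates on the unit sphere *)

(** On the sphere 1 + rho^2 = 1 / |z_(n+1)|^2. The n head coordinates give 2 n (1 + rho^2) f_rho /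
    rho, and the [dslope] terms sum to (1 + rho^2) (f_rho_rho - f_rho / rho), which turns 2 n into 2
    n - 1. The last coordinate adds (1 + rho^2) (rho f_rho + rho^2 f_rho_rho), which completes the
    factor (1 + rho^2)^2. *)
Lemma Re_sum_Ltilde (R : realType) n (f : R -> R -> R)
    (theta : 'rV[R[i]]_(n + 1) -> R) z :
  in_D f -> hnorm z = 1 -> zlast z != 0 ->
  4 * (\sum_(j < n) complex.Re (tangentbar z (dbar_head theta f j z) (lshift 1 j))
       + complex.Re (tangentbar z (dbar_last theta f z) (rshift n ord0))) =
  Ltilde n f (rho z) (theta z).
Proof.
move=> hf h1 z0; rewrite (Re_tangentbar_last theta f z0).
rewrite (eq_bigr _ (fun j _ => Re_tangentbar_head theta f j z0)).
set b := sqmod (zlast z); set qt := dtheta _ _ _; set p := fr_over _ _ _.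
set p' := frr _ _ _.
have b0 : b != 0 by rewrite sqmod_eq0.
have ab : sqhead z = 1 - b.
  have : hnorm z ^+ 2 = sqhead z + b.
    by rewrite hnormE sqr_sqrtr// (addr_ge0 (sqhead_ge0 z) (sqmod_ge0 _)).
  by rewrite h1 expr1n => ->; rewrite addrK.
have r2 : rho z ^+ 2 = (1 - b) / b by rewrite sqr_rho ab.
(* Holds also at z' = 0, where f_rho / rho stands for f_rho_rho and so p' = p. *)
have pE : sqhead z * ((p' - p) / (2 * sqhead z)) = (p' - p) / 2.
  have [a0|a0] := eqVneq (sqhead z) 0; last by field.
  by rewrite a0 mul0r /p' /p /frr /fr_over /drho_over_rho rho_sqhead0// eqxx subrr mul0r.
set e := (p' - p) / (2 * sqhead z) in pE *.
rewrite (eq_bigr (fun j => p / (2 * b)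
    + sqmod (z 0 (lshift 1 j)) * (e / (2 * b) + qt / 4))); last first.
  by move=> j _; field.
rewrite big_split/= -!mulr_suml -/(sqhead z) sumr_const card_ord.
rewrite (_ : sqhead z * _ = (p' - p) / 2 / (2 * b) + (1 - b) * qt / 4); last first.
  by rewrite -pE -ab; field.
rewrite drho_rho_mul_drho// -/p' -mulr_natl.
rewrite /Ltilde -/(fr_over theta f z) -/p -/qt -/(frr theta f z) -/p'.
rewrite (_ : rho z * (drho f (rho z) (theta z) + rho z * p') =
  rho z * drho f (rho z) (theta z) + rho z ^+ 2 * p'); last by ring.
by rewrite r2; field.
Qed.

Theorem proposition2p3 (R : realType) (n : nat) (hn : (1 <= n)%N)
    (psi : 'rV[R[i]]_(n + 1) -> R * R) (hpsi : is_psi psi)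
    (f : R -> R -> R) (hf : in_D f) :
  let F : 'rV[R[i]]_(n + 1) -> R[i] :=
    fun z => (f (psi z).1 (psi z).2)%:C in
  sub_laplacian_defined [set z | zlast z <> 0] F /\
  (forall z : 'rV[R[i]]_(n + 1), hnorm z = 1 -> zlast z <> 0 ->
     sub_laplacian F z = (Ltilde n f (psi z).1 (psi z).2)%:C).
Proof.
move=> F.
pose theta (z : 'rV[R[i]]_(n + 1)) : R := (psi ((hnorm z)^-1%:C *: z)).2.
have theta_arg z : zlast z != 0 -> is_arg (zlast z) (theta z).
  by move=> z0; have [] := psi_polar hpsi z0.
have GE z : zlast z != 0 -> polar theta f z = sphere_ext F z.
  by move=> z0; rewrite /polar /sphere_ext /F (psi_polar hpsi z0).1.
pose b k z := coef (fun j => dbar_head theta f j z) (dbar_last theta f z) k.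
have HU k z : zlast z != 0 ->
    exists a', has_dz (coef (Thead theta f) (Tlast theta f) k) z a' (b k z).
  move=> z0; rewrite /b; move: k; apply: ord_last_ind => [j|]; rewrite ?coefL ?coefR.
    exact: has_dz_Thead.
  exact: has_dz_Tlast.
have second := second_order_real GE (has_dz_polar_f theta_arg hf)
  (tangent_dpolar theta f) HU.
split=> [z /eqP z0|z h1 /eqP z0]; first by have [] := second z z0.
have [_ _ _ E] := second z z0.
(* [theta] and [rho] describe [psi] at the normalised point, which is z itself on the sphere. *)
have -> : psi z = psi ((hnorm z)^-1%:C *: z) by rewrite h1 invr1 scale1r.
rewrite (psi_polar hpsi z0).1 -/(theta z) -(Re_sum_Ltilde theta hf h1 z0).
(* The factor 4 in [Re_sum_Ltilde] is the 2 in front of L times the 2 from adding conjugate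
   terms. *)
rewrite /sub_laplacian (eq_bigr _ (fun k _ => E k)) -mulr_sumr sum_last /b !coefR.
under eq_bigr do rewrite coefL.
rewrite realcM (realc_nat 4) realcD rmorph_sum; ring.
Qed.
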